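(* Let $\Omega,\mathcal L,\mathcal E,n_{\mathcal E},t_s,\tau,\Delta t,n_t$, the forces $(\boldsymbol f_{\epsilon})_{\epsilon\in\mathcal E}$, the array response matrix $\boldsymbol A(t)$, the snapshots $\boldsymbol\varphi_j$, the matrices $\mathbb M,\mathbb S,\boldsymbol R$, the ROM snapshots $\boldsymbol\varphi_j^{\mathrm{ROM}}$ and the ROM propagator $\boldsymbol{\mathcal P}^{\mathrm{ROM}}$ be as defined in the context, and assume that the $n_tn_{\mathcal E}$ columns of $\boldsymbol\Phi=(\boldsymbol\varphi_0,\ldots,\boldsymbol\varphi_{n_t-1})$ are linearly independent in $L^2(\Omega;\mathbb R^m)$. Define the data matrices $$\boldsymbol D_j=\boldsymbol A(t_j)+\boldsymbol A^T(-t_j)\in\mathbb R^{n_{\mathcal E}\times n_{\mathcal E}},\qquad t_j=j\Delta t,\quad j\ge 0 .$$ Then: (i) The data matrices satisfy $$\boldsymbol D_j=\int_\Omega \boldsymbol\varphi_0^T(\boldsymbol x)\,\boldsymbol\varphi_j(\boldsymbol x)\,d\boldsymbol x=\big(\boldsymbol\varphi_0^{\mathrm{ROM}}\big)^T\boldsymbol\varphi_j^{\mathrm{ROM}},\qquad j=0,\ldots,n_t-1 .$$ (ii) The ROM is determined by the data matrices $\{\boldsymbol D_j\}_{j=0}^{n_t}$: there is a map, depending only on $n_t$, $n_{\mathcal E}$ and the chosen block Cholesky rule (and not on $\Omega$, $\mathcal L$, the forces or the snapshots), that sends $(\boldsymbol D_0,\ldots,\boldsymbol D_{n_t})$ to the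 ROM propagator $\boldsymbol{\mathcal P}^{\mathrm{ROM}}$ and the ROM snapshots $(\boldsymbol\varphi_j^{\mathrm{ROM}})_{j\ge 0}$. (iii) The ROM propagator matrix $\boldsymbol{\mathcal P}^{\mathrm{ROM}}$ has an unreduced, upper Hessenberg block structure: writing $\boldsymbol{\mathcal P}^{\mathrm{ROM}}=(\mathcal P^{\mathrm{ROM}}_{l,j})_{0\le l,j\le n_t-1}$ with $n_{\mathcal E}\times n_{\mathcal E}$ blocks, one has $\mathcal P^{\mathrm{ROM}}_{l,j}=0$ whenever $l\ge j+2$, and $\mathcal P^{\mathrm{ROM}}_{j+1,j}\neq 0$ for $0\le j\le n_t-2$.
   Context: Setting. $\Omega\subset\mathbb R^d$, $d\in\{2,3\}$, is a bounded, simply connected domain with piecewise smooth boundary. All functions are real valued. $\mathcal L$ is a first order partial differential operator in $\boldsymbol x$, acting on $L^2(\Omega;\mathbb R^m)$ with homogeneous boundary conditions, and it is skew-adjoint, so that $e^{-t\mathcal L}$, $t\in\mathbb R$, is a strongly continuous group of unitary (orthogonal) operators on $L^2(\Omega;\mathbb R^m)$. $\mathcal E\subset\mathbb N^2$ is a finite set of excitation indices with cardinality $n_{\mathcal E}$. For each $\epsilon\in\mathcal E$, $\boldsymbol f_\epsilon\in L^2((-t_s,t_s)\times\Omega;\mathbb R^m)$, with $t_s>0$, is a force extended by zero for $t\notin(-t_s,t_s)$. The wave field $\boldsymbol\psi_\epsilon$ is the solution of $\partial_t\boldsymbol\psi_\epsilon+\mathcal L\boldsymbol\psi_\epsilon=\boldsymbol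 f_\epsilon$ for $t\in\mathbb R$, $\boldsymbol x\in\Omega$, with $\boldsymbol\psi_\epsilon=0$ for $t<-t_s$; that is, $\boldsymbol\psi_\epsilon(t,\cdot)=\int_{-t_s}^{t}e^{-(t-t')\mathcal L}\boldsymbol f_\epsilon(t',\cdot)\,dt'$ for $t\ge -t_s$. The array response matrix $\boldsymbol A(t)\in\mathbb R^{n_{\mathcal E}\times n_{\mathcal E}}$, $t\in\mathbb R$, has entries $$\boldsymbol A_{\epsilon',\epsilon}(t)=\int_{-t_s}^{t_s}dt'\int_\Omega d\boldsymbol x\,[\boldsymbol f_{\epsilon'}(-t',\boldsymbol x)]^T\boldsymbol\psi_\epsilon(t-t',\boldsymbol x),\qquad \epsilon',\epsilon\in\mathcal E .$$ Snapshots. Let $\boldsymbol\psi=(\boldsymbol\psi_\epsilon)_{\epsilon\in\mathcal E}$, an $m\times n_{\mathcal E}$ matrix valued field; operators act columnwise on such fields. Fix $\tau\ge t_s$, a time step $\Delta t>0$ and a positive integer $n_t$. Set $\boldsymbol\varphi(t,\boldsymbol x)=\boldsymbol\psi(t+\tau,\boldsymbol x)$, $t_j=j\Delta t$ and $\boldsymbol\varphi_j(\boldsymbol x)=\boldsymbol\varphi(t_j,\boldsymbol x)$ for $j\ge0$. The propagator is $\mathcal P=e^{-\Delta t\,\mathcal L}$, so that $\boldsymbol\varphi_{j+1}=\mathcal P\boldsymbol\varphi_j$ for $j\ge 0$. Let $\boldsymbol\Phi=(\boldsymbol\varphi_0,\ldots,\boldsymbol\varphi_{n_t-1})$, with $m$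 rows and $n_tn_{\mathcal E}$ columns. Reduced order model (ROM). Assume the columns of $\boldsymbol\Phi$ are linearly independent. The mass and stiffness matrices, of size $n_tn_{\mathcal E}\times n_tn_{\mathcal E}$, are $$\mathbb M=\int_\Omega\boldsymbol\Phi^T(\boldsymbol x)\boldsymbol\Phi(\boldsymbol x)\,d\boldsymbol x,\qquad \mathbb S=\int_\Omega\boldsymbol\Phi^T(\boldsymbol x)\,\mathcal P\boldsymbol\Phi(\boldsymbol x)\,d\boldsymbol x .$$ $\boldsymbol R\in\mathbb R^{n_tn_{\mathcal E}\times n_tn_{\mathcal E}}$ is the block upper triangular matrix (blocks of size $n_{\mathcal E}\times n_{\mathcal E}$) of the block Gram-Schmidt orthogonalization $\boldsymbol\Phi(\boldsymbol x)=\boldsymbol V(\boldsymbol x)\boldsymbol R$, $\int_\Omega\boldsymbol V^T\boldsymbol V\,d\boldsymbol x=I_{n_tn_{\mathcal E}}$; equivalently, $\boldsymbol R$ is the block Cholesky square root of $\mathbb M$, $\mathbb M=\boldsymbol R^T\boldsymbol R$, and $\boldsymbol V=\boldsymbol\Phi\boldsymbol R^{-1}$. Such an $\boldsymbol R$ is unique only up to left multiplication by a block diagonal orthogonal matrix, so a block Cholesky rule is fixed once and for all: a function assigning to each symmetric positive definite matrix $M$ of size $n_tn_{\mathcal E}$ one block upper triangular matrix $R$ with $R^TR=M$ (for instance the one with symmetric positive definite diagonal blocks), and $\boldsymbol R$ is the matrix assigned to $\mathbb M$. The Galerkin coefficient matrices $\boldsymbol g_j\in\mathbb R^{n_tn_{\mathcal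 E}\times n_{\mathcal E}}$, $j\ge0$, are defined by $\boldsymbol g_0=$ the first $n_{\mathcal E}$ columns of $I_{n_tn_{\mathcal E}}$ and $\boldsymbol R^{-T}\mathbb M\,\boldsymbol g_{j+1}=\boldsymbol R^{-T}\mathbb S\,\boldsymbol g_j$, where $\boldsymbol R^{-T}=(\boldsymbol R^{-1})^T$. The ROM snapshots are $\boldsymbol\varphi_j^{\mathrm{ROM}}=\boldsymbol R\,\boldsymbol g_j\in\mathbb R^{n_tn_{\mathcal E}\times n_{\mathcal E}}$, $j\ge 0$, and the ROM propagator is $\boldsymbol{\mathcal P}^{\mathrm{ROM}}=\boldsymbol R^{-T}\mathbb S\boldsymbol R^{-1}\in\mathbb R^{n_tn_{\mathcal E}\times n_tn_{\mathcal E}}$; they satisfy $\boldsymbol\varphi_{j+1}^{\mathrm{ROM}}=\boldsymbol{\mathcal P}^{\mathrm{ROM}}\boldsymbol\varphi_j^{\mathrm{ROM}}$. *)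

(* Defs.v *)
From HB Require Import structures.
From mathcomp Require Import all_boot all_order all_algebra.
From mathcomp Require Import all_classical all_reals all_analysis.
Set Implicit Arguments. Unset Strict Implicit. Unset Printing Implicit Defensive.
Import Order.TTheory GRing.Theory Num.Theory.
Import numFieldNormedType.Exports.
Local Open Scope classical_set_scope.
Local Open Scope ring_scope.

(* Borel structure on matrices, in particular on R^n = 'rV[R]_n: the product
   sigma-algebra of the entries. *)
Definition matrix_measure_display : measure_display -> measure_display.
Proof. exact. Qed.

Section measurable_matrix.
Context {d} {T : sigmaRingType d}.
Variables m n : nat.

Definition matrix_measurable : set (set 'M[T]_(m, n)) :=
  <<s \bigcup_(ij in [set: 'I_m * 'I_n])
        preimage_set_system setT (fun A : 'M[T]_(m, n) => A ij.1 ij.2) measurable >>.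

Let matrix_set0 : matrix_measurable set0.
Proof. exact: sigma_algebra0. Qed.

Let matrix_setC A : matrix_measurable A -> matrix_measurable (~` A).
Proof. exact: sigma_algebraC. Qed.

Let matrix_bigcup (F : _^nat) : (forall i, matrix_measurable (F i)) ->
  matrix_measurable (\bigcup_i (F i)).
Proof. exact: sigma_algebra_bigcup. Qed.

HB.instance Definition _ := @isMeasurable.Build (matrix_measure_display d)
  'M[T]_(m, n) matrix_measurable matrix_set0 matrix_setC matrix_bigcup.
End measurable_matrix.


Lemma sigma_finite_prod d1 d2 (T1 : measurableType d1) (T2 : measurableType d2)
    (R : realType) (m1 : {sigma_finite_measure set T1 -> \bar R})
    (m2 : {sigma_finite_measure set T2 -> \bar R}) :
  sigma_finite setT (m1 \x m2)%E.
Proof.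
have /sigma_finiteP[F [TF ndF Foo]] := sigma_finiteT m1.
have /sigma_finiteP[G [TG ndG Goo]] := sigma_finiteT m2.
exists (fun n => F n `*` G n).
  rewrite -setXTT TF TG predeqE => -[x y]; split.
    move=> [/= [n _ Fnx] [k _ Gky]]; exists (maxn n k) => //; split.
    - by move: x Fnx; exact/subsetPset/ndF/leq_maxl.
    - by move: y Gky; exact/subsetPset/ndG/leq_maxr.
  by move=> [n _ []/= ? ?]; split; exists n.
move=> k; have [? ?] := Foo k; have [? ?] := Goo k.
split; first exact: measurableX.
by rewrite product_measure1E// lte_mul_pinfty// ge0_fin_numE.
Qed.

Section lebesgue_rV.
Variable R : realType.

Definition cons_rV n (p : R * 'rV[R]_n) : 'rV[R]_n.+1 :=
  row_mx (const_mx p.1 : 'rV[R]_1) p.2.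

Lemma measurable_entry p q (i : 'I_p) (j : 'I_q) :
  measurable_fun setT (fun A : 'M[R]_(p, q) => A i j).
Proof.
move=> _ Y mY; rewrite setTI; apply: sub_sigma_algebra => /=.
by exists (i, j) => //; exists Y => //; rewrite setTI.
Qed.

Lemma measurable_fun_matrix d (T : measurableType d) p q
    (f : T -> 'M[R]_(p, q)) :
  (forall i j, measurable_fun setT (fun x => f x i j)) -> measurable_fun setT f.
Proof.
move=> mf; apply: (@measurability _ _ _ _ setT f
  (\bigcup_(ij in [set: 'I_p * 'I_q])
    preimage_set_system setT (fun A : 'M[R]_(p, q) => A ij.1 ij.2) measurable)).
  by [].
move=> _ [_ [[i j] _ [B mB <-]] <-] /=.
by rewrite setTI -comp_preimage; exact: mf.
Qed.

Lemma measurable_cons_rV n : measurable_fun setT (@cons_rV n).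
Proof.
apply: measurable_fun_matrix => i j.
rewrite /cons_rV; case: (split_ordP (j : 'I_(1 + n))) => k ->.
  rewrite (_ : (fun _ => _) = fst) //.
  apply/funext => x; apply: etrans (row_mxEl _ _ _ _) _; exact: mxE.
rewrite (_ : (fun _ => _) = (fun A : 'rV[R]_n => A i k) \o snd).
  by apply: measurableT_comp => //; exact: measurable_entry.
by apply/funext => x; exact: row_mxEr.
Qed.

Section cons.
Variables (n : nat) (m : {sigma_finite_measure set 'rV[R]_n -> \bar R}).

Definition lebesgue_cons : set 'rV[R]_n.+1 -> \bar R :=
  pushforward (@lebesgue_measure R \x m)%E (@cons_rV n).

Let mcons := @measurable_cons_rV n.

Let lebesgue_cons0 : lebesgue_cons set0 = 0%E.
Proof. by rewrite /lebesgue_cons /pushforward preimage_set0 measure0. Qed.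

Let lebesgue_cons_ge0 A : (0 <= lebesgue_cons A)%E.
Proof. exact: measure_ge0. Qed.

Let lebesgue_cons_sigma_additive : semi_sigma_additive lebesgue_cons.
Proof.
exact: (@measure_semi_sigma_additive _ _ _ [the measure _ _ of
  pushforward (@lebesgue_measure R \x m)%E (@cons_rV n)]).
Qed.

HB.instance Definition _ := isMeasure.Build _ _ _ lebesgue_cons
  lebesgue_cons0 lebesgue_cons_ge0 lebesgue_cons_sigma_additive.

Let lebesgue_cons_sigma_finite : sigma_finite setT lebesgue_cons.
Proof.
have [F TF Foo] := sigma_finite_prod (@lebesgue_measure R) m.
pose uncons (v : 'rV[R]_n.+1) : R * 'rV[R]_n := (v 0 0, rsubmx (v : 'rV[R]_(1 + n))).
have muncons : measurable_fun setT uncons.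
  apply/measurable_fun_pairP; split.
    exact: measurable_entry.
  apply: measurable_fun_matrix => i j.
  rewrite (_ : (fun _ => _) = (fun v : 'rV[R]_n.+1 => v i (rshift 1 j))).
    exact: measurable_entry.
  by apply/funext => v /=; rewrite mxE.
have consK : cancel (@cons_rV n) uncons.
  move=> [x v]; congr pair; last by rewrite row_mxKr.
  rewrite /= (_ : 0 = lshift n (0 : 'I_1)); last exact: ord_inj.
  by apply: etrans (row_mxEl _ _ _ _) _; exact: mxE.
exists (fun k => uncons @^-1` F k).
  by rewrite -preimage_bigcup -TF preimage_setT.
move=> k; have [mF mFoo] := Foo k.
have mU : measurable (uncons @^-1` F k) by rewrite -[X in measurable X]setTI; exact: muncons.
split => //.
rewrite /lebesgue_cons /pushforward -comp_preimage.
by rewrite (_ : uncons \o _ = id) //; apply/funext => p; rewrite /= consK.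
Qed.

HB.instance Definition _ := Measure_isSigmaFinite.Build _ _ _ lebesgue_cons
  lebesgue_cons_sigma_finite.
End cons.

(* Lebesgue measure on R^n, as the n-fold product of the one on R; the library
   only has the latter. *)
Fixpoint lebesgue_rV n : {sigma_finite_measure set 'rV[R]_n -> \bar R} :=
  if n is k.+1 then lebesgue_cons (lebesgue_rV k) else \d_(0 : 'rV[R]_0).
End lebesgue_rV.

Notation field R d m := ('rV[R]_d -> 'cV[R]_m).

Section domains.
Variables (R : realType) (d : nat).
Implicit Types O : set 'rV[R]_d.

Definition boundary O : set 'rV[R]_d := closure O `\` interior O.

(* Null-homotopy of loops only: for the connected open sets below,
   path-connectedness is automatic. *)
Definition loops_contract O : Prop :=
  forall g : R -> 'rV[R]_d,
    {within `[0, 1], continuous g} ->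
    (forall s, `[0, 1]%classic s -> O (g s)) -> g 0 = g 1 ->
  exists H : R * R -> 'rV[R]_d,
    [/\ {within `[0, 1] `*` `[0, 1], continuous H},
        (forall p, (`[0, 1] `*` `[0, 1])%classic p -> O (H p)),
        (forall s, `[0, 1]%classic s -> H (0, s) = g s),
        (forall s, `[0, 1]%classic s -> H (1, s) = g 0) &
        (forall t, `[0, 1]%classic t -> H (t, 0) = g 0 /\ H (t, 1) = g 0)].

Fixpoint Ck (p : nat) (V : normedModType R) (k : nat) (W : set 'rV[R]_p)
    (f : 'rV[R]_p -> V) : Prop :=
  (forall x, W x -> {for x, continuous f}) /\
  (if k is l.+1 then
     forall i : 'I_p, (forall x, W x -> derivable f x (delta_mx 0 i)) /\
                      Ck l W ('D_(delta_mx 0 i) f)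
   else True).

Definition unit_cube (p : nat) : set 'rV[R]_p :=
  [set y | forall i, 0 <= y 0 i <= 1].

(* The boundary is a finite union of smooth (d-1)-dimensional parametrized
   patches. As usual, regularity and injectivity of a patch may fail on the
   boundary of its parameter cube (edges, corners, tips of cones). *)
Definition piecewise_smooth_boundary O : Prop :=
  exists (n : nat) (g : 'I_n -> 'rV[R]_d.-1 -> 'rV[R]_d),
    (forall k, exists W : set 'rV[R]_d.-1,
      [/\ open W, @unit_cube d.-1 `<=` W, forall l, Ck l W (g k),
          (forall y z, interior (@unit_cube d.-1) y ->
             interior (@unit_cube d.-1) z -> g k y = g k z -> y = z) &
          (forall y, interior (@unit_cube d.-1) y ->
             \rank ('J (g k) y) = d.-1)]) /\
    boundary O = \bigcup_(k in [set: 'I_n]) (g k @` @unit_cube d.-1).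

Definition admissible_domain O : Prop :=
  [/\ open O, connected O, O !=set0, bounded_set O &
      loops_contract O /\ piecewise_smooth_boundary O].

End domains.

(* L^2(O; R^m) is handled through representatives: its elements are fields on
   R^d, restricted to O and compared almost everywhere on O. *)
Section L2.
Variables (R : realType) (d m : nat) (O : set 'rV[R]_d).
Implicit Types u v w : field R d m.

Definition L2 u : Prop :=
  forall i, ((fun x => u x i 0) \_ O) \in Lfun (lebesgue_rV R d) 2%:E.

Definition L2eq u v : Prop := u = v %[ae lebesgue_rV R d in O].

Definition L2dot u v : R :=
  \int[lebesgue_rV R d]_(x in O) ((u x)^T *m v x) 0 0.

Definition L2norm u : R := Num.sqrt (L2dot u u).

(* The integral over D of an L^2(O; R^m)-valued function F of a real variable,
   in the weak (Pettis) sense; it is the Bochner integral when the latter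
   exists. *)
Definition is_L2_integral (D : set R) (F : R -> field R d m) v : Prop :=
  L2 v /\
  forall g, L2 g ->
    (@lebesgue_measure R).-integrable D (fun s => (L2dot g (F s))%:E) /\
    L2dot g v = \int[@lebesgue_measure R]_(s in D) L2dot g (F s).

Record operator := Operator {
  dom : set (field R d m);
  op_fun :> field R d m -> field R d m
}.
Implicit Type L : operator.

Definition linear_operator L : Prop :=
  [/\ forall u, dom L u -> L2 u /\ L2 (L u),
      dom L 0,
      (forall a u v, dom L u -> dom L v ->
         dom L (a *: u + v) /\ L2eq (L (a *: u + v)) (a *: L u + L v)) &
      (forall u v, dom L u -> L2 v -> L2eq u v ->
         dom L v /\ L2eq (L u) (L v))].

Definition densely_defined L : Prop :=
  forall u, L2 u ->
  forall e : R, 0 < e -> exists v, dom L v /\ L2norm (u - v) < e.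

(* L^* = - L, domains included: u is in the domain of L^* with L^* u = - w
   if and only if u is in the domain of L with L u = w. *)
Definition skew_adjoint L : Prop :=
  [/\ linear_operator L, densely_defined L &
      forall u w, L2 u -> L2 w ->
        (forall v, dom L v -> L2dot (L v) u = L2dot v (- w)) <->
        (dom L u /\ L2eq w (L u))].

Definition first_order_expr (A : 'I_d -> 'rV[R]_d -> 'M[R]_m)
    (B : 'rV[R]_d -> 'M[R]_m) u : field R d m :=
  fun x => \sum_(i < d) A i x *m 'D_(delta_mx 0 i) u x + B x *m u x.

(* Wherever an element of the domain is C^1, L acts on it as a first order
   differential expression. No regularity of the coefficients is imposed, so
   elements of the domain need not be smooth. *)
Definition acts_as L A B : Prop :=
  forall u (W : set 'rV[R]_d), dom L u -> open W -> W `<=` O -> Ck 1 W u ->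
    L u = first_order_expr A B u %[ae lebesgue_rV R d in W].

Definition first_order_pdo L : Prop := exists A B, acts_as L A B.

(* Membership in the domain of L up to boundary conditions: L u, computed by
   testing against the elements of the domain with compact support in O, is in
   L^2(O; R^m). *)
Definition in_maximal_domain L u : Prop :=
  L2 u /\
  exists w, L2 w /\
    forall v, dom L v ->
      (exists K, [/\ compact K, K `<=` O & forall x, ~ K x -> v x = 0]) ->
      L2dot (L v) u = L2dot v (- w).

(* Homogeneous boundary condition b u = 0, with b matrix valued: it holds for
   the elements of the domain where they are continuous up to the boundary,
   and a field u that is C^1 up to the boundary, with L u in L^2 and b u = 0 on
   the boundary, is in the domain. *)
Definition homogeneous_bc L : Prop :=
  exists b : 'rV[R]_d -> 'M[R]_m,
    (forall u (W : set 'rV[R]_d), dom L u -> open W ->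
       {within closure O `&` W, continuous u} ->
       forall x, boundary O x -> W x -> b x *m u x = 0) /\
    (forall u (W : set 'rV[R]_d), open W -> closure O `<=` W -> Ck 1 W u ->
       in_maximal_domain L u ->
       (forall x, boundary O x -> b x *m u x = 0) -> dom L u).

Definition unitary_group (U : R -> field R d m -> field R d m) : Prop :=
  [/\ forall t u, L2 u -> L2 (U t u),
      (forall t a u v, L2 u -> L2 v ->
         L2eq (U t (a *: u + v)) (a *: U t u + U t v)),
      (forall u, L2 u -> L2eq (U 0 u) u /\
         forall s t, L2eq (U (s + t) u) (U s (U t u))),
      (forall t u v, L2 u -> L2 v -> L2dot (U t u) (U t v) = L2dot u v) &
      (forall u, L2 u -> L2norm (U t u - u) @[t --> 0] --> 0)].

(* U t = e^(- t L): U is the strongly continuous unitary group with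
   infinitesimal generator - L, domains included. *)
Definition is_exp_opp L (U : R -> field R d m -> field R d m) : Prop :=
  unitary_group U /\
  forall u w, L2 u -> L2 w ->
    (dom L u /\ L2eq w (L u)) <->
    L2norm (t^-1 *: (U t u - u) + w) @[t --> 0^'] --> 0.

(* A force in L^2((-ts, ts) x O; R^m), extended by zero. Every class has a
   representative all of whose time slices are in L^2(O; R^m), and nothing
   depends on which one is taken. *)
Definition is_force (ts : R) (f : R -> field R d m) : Prop :=
  [/\ forall i, ((fun p : R * 'rV[R]_d => f p.1 p.2 i 0)
          \_ (`]- ts, ts[ `*` O))
        \in Lfun (@lebesgue_measure R \x lebesgue_rV R d)%E 2%:E,
      forall t, L2 (f t) &
      forall t, ~ (- ts < t < ts) -> f t = 0].

(* Duhamel's formula for d_t psi + L psi = f, psi = 0 for t < - ts. *)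
Definition is_wave_field (U : R -> field R d m -> field R d m) (ts : R)
    (f psi : R -> field R d m) : Prop :=
  (forall t, t < - ts -> L2 (psi t) /\ L2eq (psi t) 0) /\
  (forall t, - ts <= t ->
     is_L2_integral `[- ts, t] (fun s => U (t - s) (f s)) (psi t)).

End L2.

Section snapshots.
Variables (R : realType) (d m nE : nat) (O : set 'rV[R]_d).
(* An enumeration of the set of excitation indices. *)
Variable E : nE.-tuple (nat * nat).

Definition array_response (ts : R) (f psi : nat * nat -> R -> field R d m)
    (t : R) : 'M[R]_nE :=
  \matrix_(k', k) \int[@lebesgue_measure R]_(s in `[- ts, ts])
    L2dot O (f (tnth E k') (- s)) (psi (tnth E k) (t - s)).

Definition data_matrix (ts dt : R) (f psi : nat * nat -> R -> field R d m)
    (j : nat) : 'M[R]_nE :=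
  array_response ts f psi (j%:R * dt) +
  (array_response ts f psi (- (j%:R * dt)))^T.

Definition snapshot (tau dt : R) (psi : nat * nat -> R -> field R d m)
    (j : nat) (x : 'rV[R]_d) : 'M[R]_(m, nE) :=
  \matrix_(i, k) psi (tnth E k) (j%:R * dt + tau) x i 0.

Definition snapshots (nt : nat) (tau dt : R)
    (psi : nat * nat -> R -> field R d m) (x : 'rV[R]_d) :
    'M[R]_(m, \sum_(j < nt) nE) :=
  \mxrow_(j < nt) snapshot tau dt psi j x.

End snapshots.

Section matrix_fields.
Variables (R : realType) (d m : nat) (O : set 'rV[R]_d).

Definition colwise n (T : field R d m -> field R d m)
    (F : 'rV[R]_d -> 'M[R]_(m, n)) : 'rV[R]_d -> 'M[R]_(m, n) :=
  fun x => \matrix_(i, k) T (fun y => col k (F y)) x i 0.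

Definition mxintegral p q (F : 'rV[R]_d -> 'M[R]_(p, q)) : 'M[R]_(p, q) :=
  \matrix_(i, j) \int[lebesgue_rV R d]_(x in O) F x i j.

Definition gram p q (F : 'rV[R]_d -> 'M[R]_(m, p))
    (G : 'rV[R]_d -> 'M[R]_(m, q)) : 'M[R]_(p, q) :=
  mxintegral (fun x => (F x)^T *m G x).

Definition L2_free_columns n (F : 'rV[R]_d -> 'M[R]_(m, n)) : Prop :=
  forall c : 'cV[R]_n,
    {ae lebesgue_rV R d, forall x, O x -> F x *m c = 0} -> c = 0.

End matrix_fields.

Section rom.
Variables (R : realType) (nt nE : nat).
Local Notation N := (\sum_(j < nt) nE)%N.

Definition block (A : 'M[R]_N) (l j : 'I_nt) : 'M[R]_nE :=
  @submxblock R nt nt (fun=> nE) (fun=> nE) A l j.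

Definition sym_pos_def n (A : 'M[R]_n) : Prop :=
  A^T = A /\ forall v : 'cV[R]_n, v != 0 -> 0 < (v^T *m A *m v) 0 0.

Definition block_cholesky_rule (chol : 'M[R]_N -> 'M[R]_N) : Prop :=
  forall A, sym_pos_def A ->
    (forall l j : 'I_nt, (j < l)%N -> block (chol A) l j = 0) /\
    (chol A)^T *m chol A = A.

(* [pid_mx nE] is made of the first nE columns of the identity. *)
Definition galerkin (M S Rm : 'M[R]_N) (g : nat -> 'M[R]_(N, nE)) : Prop :=
  g 0%N = pid_mx nE /\
  forall j, (invmx Rm)^T *m M *m g j.+1 = (invmx Rm)^T *m S *m g j.

Definition rom_propagator (S Rm : 'M[R]_N) : 'M[R]_N :=
  (invmx Rm)^T *m S *m invmx Rm.

End rom.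

(* Main.v *)
From HB Require Import structures.
Require Import Defs.
From mathcomp Require Import all_boot all_order all_algebra.
From mathcomp Require Import all_classical all_reals all_analysis.
From mathcomp Require Import measurable_realfun ring lra.
Import Order.TTheory GRing.Theory Num.Theory.
Import numFieldNormedType.Exports.
Local Open Scope classical_set_scope.
Local Open Scope ring_scope.

(** Why the theorem holds.

    Everything rests on the identity D_j = <phi_0, phi_j>. Write
    h s r = <f' s, U (t + s - r) (f r)> for two forces f' and f, and t = t_j.
    Duhamel's formula turns the entry of A(t) into the integral of h over the
    half plane r <= s + t, the entry of the transpose of A(- t) into the integral
    of h over r >= s + t, and the entry of <phi_0, phi_j> into the integral of h
    over the whole plane. The difficulty is measure theoretic: wave fields are
    weak integrals, and h is only known to be measurable in each variable
    separately, so Fubini's theorem does not apply. Weak integration however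
    gives the equality of the two iterated integrals of h over every quadrant,
    and |h s r| <= |f' s| |f r| with integrable norms (force_norm_integrable).
    This is enough to cut the plane along the line (diagonal_split): the defect
    of the formula, as a function of the corner (T, T + t) of a quadrant, has
    increments bounded by the square of the increments of a continuous function,
    so it is constant (eq_of_square_control). The identity itself is
    pairing_identity.

    Since the group is isometric and the forces are off after the time ts,
    <phi_l, phi_j> depends on j - l only. So the mass matrix is the symmetric
    block Toeplitz matrix with first row D_0, ..., D_(nt - 1), and the stiffness
    matrix, whose blocks are <phi_l, phi_(j + 1)>, involves in addition D_nt
    (mass_matrix_data, stiffness_matrix_data). These two matrices and the
    Cholesky rule determine the whole reduced order model.

    The rest is block algebra. The stiffness matrix is the mass matrix shifted
    by one block column. Hence the Galerkin coefficients g_j with j < nt are the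
    block columns of the identity (galerkin_seq_lt), which gives the second
    equality of (i), and the ROM propagator P shifts the block columns of the
    Cholesky factor R. As R and its inverse are block upper triangular,
    P = (P R) R^-1 is block upper Hessenberg, with subdiagonal blocks that are
    products of invertible diagonal blocks (propagator_block). *)

Set Implicit Arguments. Unset Strict Implicit. Unset Printing Implicit Defensive.

(** * Primitives of integrable functions on the line *)

Section primitives.
Variable R : realType.
Local Notation mu := (@lebesgue_measure R).
Implicit Types (f g : R -> R) (x y : R).

Definition primitive f x : R := \int[mu]_(t in `]-oo, x]) f t.

Local Notation integrableT f := (mu.-integrable setT (EFin \o f)).

Lemma integrableT_sub f (A : set R) : measurable A -> integrableT f ->
  mu.-integrable A (EFin \o f).
Proof. by move=> mA; apply: integrableS. Qed.

Lemma integrableT_le f g : measurable_fun setT f -> integrableT g ->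
  (forall x, `|f x| <= g x) -> integrableT f.
Proof.
move=> mf ig fg; apply: (le_integrable measurableT _ _ ig).
  exact/measurable_EFinP.
move=> x _ /=; rewrite lee_fin (le_trans (fg x))// ler_norm//.
Qed.

Lemma primitiveB f x y : integrableT f -> x <= y ->
  primitive f y - primitive f x = \int[mu]_(t in `]x, y]) f t.
Proof.
move=> If xy; by rewrite /primitive Rintegral_itvB//; exact: integrableT_sub.
Qed.

Lemma primitive_increment_le f g x y : measurable_fun setT f -> integrableT g ->
  (forall t, `|f t| <= g t) -> x <= y ->
  `|primitive f y - primitive f x| <= primitive g y - primitive g x.
Proof.
move=> mf ig fg xy; have If := integrableT_le mf ig fg.
rewrite !primitiveB//; apply: (le_trans (le_normr_Rintegral _ _)) => //.
  exact: integrableT_sub.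
apply: le_Rintegral => //; last by exact: integrableT_sub.
by apply: integrable_norm; exact: integrableT_sub.
Qed.

Lemma primitive_nondecreasing g x y : integrableT g -> (forall t, 0 <= g t) -> x <= y ->
  primitive g x <= primitive g y.
Proof.
move=> ig g0 xy; rewrite -subr_ge0 primitiveB//.
by apply: Rintegral_ge0.
Qed.

Lemma primitive_eq0 f x : (forall t, t <= x -> f t = 0) -> primitive f x = 0.
Proof.
move=> f0; rewrite /primitive (@eq_Rintegral _ _ _ _ _ (cst 0)); last first.
  by move=> t; rewrite inE/= in_itv/= => /f0.
by rewrite Rintegral_cst// mul0r.
Qed.

Lemma eq_primitive f g x : (forall t, t <= x -> f t = g t) -> primitive f x = primitive g x.
Proof.
move=> fg; apply: eq_Rintegral => t; rewrite inE/= in_itv/=; exact: fg.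
Qed.

Lemma primitive_continuous f : integrableT f -> continuous (primitive f).
Proof.
move=> If x0; set a := x0 - 1; set b := x0 + 1.
have ab : a < b by rewrite /a /b; lra.
have IE x : a <= x -> primitive f x = primitive f a + \int[mu]_(t in `[a, x]) f t.
  move=> ax; rewrite -Rintegral_itv_obnd_cbnd; last exact: integrableT_sub.
  by rewrite -primitiveB// addrCA subrr addr0.
have cw : {within `[a, b], continuous (primitive f)}.
  apply: (@subspace_eq_continuous _ _ _
      (fun x => primitive f a + \int[mu]_(t in `[a, x]) f t)).
    by move=> x; rewrite inE/= in_itv/= => /andP[ax _]; rewrite [RHS]IE.
  move=> x; apply: cvgD; first exact: cvg_cst.
  have := @parameterized_integral_continuous R a b f (ltW ab).
  by apply; exact: integrableT_sub.
have [cab _ _] := (continuous_within_itvP (primitive f) ab).1 cw.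
by apply: cab; rewrite in_itv/= /a /b; apply/andP; split; lra.
Qed.

(** A function whose increments are quadratically small with respect to those of
    a continuous function m is constant. The intermediate value theorem gives
    points where m takes n + 1 equally spaced values from m a to m b; along them,
    the increments of H add up to at most (m b - m a)^2 / n. These points may
    come in any order, because the bound is symmetric in its two points. *)
Lemma eq_of_square_control (H m : R -> R) a b : a <= b ->
  {within `[a, b], continuous m} ->
  (forall x y, a <= x -> x <= y -> y <= b -> `|H y - H x| <= (m y - m x) ^+ 2) ->
  H a = H b.
Proof.
move=> ab cm Hm.
have Hs x y : x \in `[a, b] -> y \in `[a, b] ->
    `|H y - H x| <= (m y - m x) ^+ 2.
  rewrite !in_itv/= => /andP[ax xb] /andP[ay yb].
  have [xy|/ltW yx] := leP x y; first exact: Hm.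
  by rewrite distrC -sqrrN opprB; exact: Hm.
set D := m b - m a.
have step (n : nat) : (0 < n)%N -> `|H b - H a| <= D ^+ 2 / n%:R.
  move=> n0; have n0' : n%:R != 0 :> R by rewrite pnatr_eq0 -lt0n.
  pose v i := m a + i%:R / n%:R * D.
  have pts i : (i <= n)%N -> exists2 c, c \in `[a, b] & m c = v i.
    move=> ile; apply: IVT => //.
    have t0 : 0 <= i%:R / n%:R :> R by rewrite divr_ge0.
    have t1 : i%:R / n%:R <= 1 :> R.
      by rewrite ler_pdivrMr ?ltr0n// mul1r ler_nat.
    rewrite /v /D; have [mab|/ltW mba] := leP (m a) (m b).
      by rewrite (_ : _ <= _); [|nra]; nra.
    by rewrite (_ : _ <= _); [|nra]; nra.
  have key i c : (i <= n)%N -> c \in `[a, b] -> m c = v i ->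
      `|H c - H a| <= i%:R * (D / n%:R) ^+ 2.
    have aI : a \in `[a, b] by rewrite in_itv/= lexx.
    elim: i c => [|i IH] c ile cI mc.
      apply: (le_trans (Hs _ _ aI cI)).
      by rewrite mc /v !mul0r addr0 subrr expr0n/= .
    have [c' c'I mc'] := pts i (ltnW ile).
    have := IH c' (ltnW ile) c'I mc'.
    have := Hs _ _ c'I cI.
    rewrite mc mc' /v -natr1.
    rewrite (_ : m a + (i%:R + 1) / n%:R * D - (m a + i%:R / n%:R * D) = D / n%:R); last by field.
    have := ler_distD (H c') (H c) (H a).
    move: ((D / n%:R) ^+ 2) (`|H c - H a|) (`|H c - H c'|) (`|H c' - H a|).
    by move=> *; lra.
  have bI : b \in `[a, b] by rewrite in_itv/= lexx ab.
  have mb : m b = v n by rewrite /v divff// mul1r /D; ring.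
  have := key n b (leqnn n) bI mb.
  rewrite (_ : n%:R * _ = D ^+ 2 / n%:R)//.
  by field.
apply/eqP; rewrite eq_sym -subr_eq0 -normr_le0; apply/ler_addgt0Pr => e e0.
rewrite add0r.
have [n n0 hn] : exists2 n : nat, (0 < n)%N & D ^+ 2 / n%:R <= e.
  have := archi_boundP (divr_ge0 (sqr_ge0 D) (ltW e0)).
  set n := Num.bound _ => hn.
  exists n.+1 => //; rewrite ler_pdivrMr ?ltr0n// mulrC -ler_pdivrMr//.
  by rewrite (le_trans (ltW hn))// ler_nat.
exact: (le_trans (step n n0)).
Qed.

End primitives.

(** * Measurability along a curve, and reflection of the line *)

(** A function of two variables that is measurable in the first one and
    continuous in the second one can be evaluated along a measurable curve:
    the curve is approximated by its roundings to multiples of 1/(n + 1), which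
    take countably many values. *)
Lemma measurable_caratheodory d (X : measurableType d) (R : realType)
    (q : X -> R -> R) (u : X -> R) :
  (forall x, measurable_fun setT (q ^~ x)) ->
  (forall s, continuous (q s)) ->
  measurable_fun setT u ->
  measurable_fun setT (fun s => q s (u s)).
Proof.
move=> mq cq mu.
pose fl n s : int := Num.floor (n.+1%:R * u s).
pose un n s : R := (fl n s)%:~R / n.+1%:R.
have n0 n : 0 < n.+1%:R :> R by rewrite ltr0n.
apply: (@measurable_fun_cvg _ _ _ _ (fun n s => q s (un n s))).
- move=> n _ Y mY; rewrite setTI.
  rewrite (_ : _ @^-1` Y = \bigcup_(z in [set: int])
    ((fun s => n.+1%:R * u s) @^-1` `[z%:~R, (z + 1)%:~R[ `&`
     (fun s => q s (z%:~R / n.+1%:R)) @^-1` Y)); last first.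
    apply/seteqP; split => [s Ys|s [z _ [/= ]]].
      exists (fl n s) => //; split => //=.
      by rewrite in_itv/=; exact: floor_itv.
    by rewrite in_itv/= -floor_eq => /eqP fz; rewrite /un /fl fz.
  apply: countable_bigcupT_measurable => // z; apply: measurableI.
    rewrite -[X in measurable X]setTI.
    apply: (measurable_funM (measurable_cst _) mu) => //.
  by rewrite -[X in measurable X]setTI; exact: mq.
move=> s _; apply: (continuous_cvg _ (cq s (u s))).
apply/cvgrPdist_lt => e e0; near=> n.
rewrite /un (_ : _ - _ = (n.+1%:R * u s - (fl n s)%:~R) / n.+1%:R); last first.
  by rewrite mulrBl mulrAC divff ?gt_eqF// mul1r.
have /andP[f1 f2] := floor_itv (n.+1%:R * u s).
rewrite ger0_norm; last by rewrite divr_ge0 ?subr_ge0.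
rewrite (@le_lt_trans _ _ (n.+1%:R^-1))//.
  rewrite ler_pdivrMr// mulVf ?gt_eqF//.
  by have := ltW f2; rewrite intrD lerBlDl.
by near: n; exact: near_infty_natSinv_lt (PosNum e0).
Unshelve. all: by end_near. Qed.

Section reflection.
Variable R : realType.
Local Notation mu := (@lebesgue_measure R).

Lemma lebesgue_measure_opp (A : set R) : measurable A ->
  mu A = pushforward mu (-%R : R -> R) A.
Proof.
move=> mA.
apply: (@lebesgue_measure_unique R (pushforward mu (-%R : measurableTypeR R -> measurableTypeR R))) => //.
move=> _ [[a b] /= _ <-].
rewrite /pushforward (_ : _ @^-1` _ = `[- b, - a[%classic); last first.
  apply/seteqP; split => x /=; rewrite !in_itv/=; lra.
rewrite !lebesgue_measure_itv/= !lte_fin ltrN2.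
by case: ifP => // _; rewrite -!EFinD opprK addrC.
Qed.

(** The image measure formula is applied to f composed with the reflection, so
    that the integrability it requires is that of f itself. *)
Lemma Rintegral_reflect (f : R -> R) c : measurable_fun setT f ->
  mu.-integrable setT (EFin \o f) ->
  \int[mu]_(s in `[- c, c]) f (- s) = \int[mu]_(s in `[- c, c]) f s.
Proof.
move=> mf If; congr fine.
pose opp : measurableTypeR R -> measurableTypeR R := -%R.
have mopp : measurable_fun setT opp by exact: oppr_measurable.
have oppI : opp @^-1` `[- c, c]%classic = `[- c, c]%classic.
  by apply/seteqP; split => x /=; rewrite /opp !in_itv/=; lra.
have fE : EFin \o f = (EFin \o (f \o opp)) \o opp.
  by apply/funext => x /=; rewrite /opp opprK.
transitivity (\int[pushforward mu opp]_(s in `[(- c)%R, c]) (f (opp s))%:E)%E.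
  apply: eq_measure_integral => //= A mA _.
  exact: lebesgue_measure_opp.
rewrite integral_pushforward//=.
- rewrite oppI; apply: eq_integral => s _ /=; by rewrite /opp opprK.
- by apply/measurable_EFinP; exact: (measurableT_comp mf).
- by rewrite oppI -fE; exact: integrableT_sub.
Qed.
End reflection.

(** * Splitting an iterated integral along a diagonal *)

(** Increments of u dominated by those of an indefinite integral make u
    continuous, because an indefinite integral is. *)
Lemma continuous_of_primitive_control (R : realType) (u g : R -> R) (c : R) :
  (@lebesgue_measure R).-integrable setT (EFin \o g) ->
  (forall x y, x <= y -> `|u y - u x| <= c * (primitive g y - primitive g x)) ->
  continuous u.
Proof.
move=> ig ug x.
have cg : {for x, continuous (primitive g)} by exact: primitive_continuous.
apply/cvgrPdist_le => e e0.
have e1 : 0 < e / (`|c| + 1) by rewrite divr_gt0// ltr_wpDl.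
have /cvgrPdist_le/(_ _ e1) := cg; apply: filterS => y Hy.
have Hc : `|c * (primitive g x - primitive g y)| <= e.
  rewrite normrM (@le_trans _ _ ((`|c| + 1) * `|primitive g x - primitive g y|))//.
    by rewrite ler_wpM2r// lerDl.
  by rewrite mulrC -ler_pdivlMr// ltr_wpDl.
have [xy|/ltW yx] := leP x y.
  rewrite distrC (le_trans (ug _ _ xy))// (le_trans _ Hc)//.
  by rewrite -opprB mulrN (le_trans (ler_norm _))// normrN.
by rewrite (le_trans (ug _ _ yx))// (le_trans _ Hc)// ler_norm.
Qed.

Section diagonal.
(** A kernel h that is only measurable in each variable separately, dominated
    by a product NF s * NG r. Joint measurability, hence Fubini's theorem, is
    not at hand: in the application, h s r is the inner product of two vectors
    of L^2 that depend weakly measurably on s and on r respectively. *)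
Variable R : realType.
Local Notation mu := (@lebesgue_measure R).
Local Notation integrableT f := (mu.-integrable setT (EFin \o f)).

Variables (h : R -> R -> R) (NF NG : R -> R).
Hypotheses (iF : integrableT NF) (iG : integrableT NG).
Hypotheses (F0 : forall s, 0 <= NF s) (G0 : forall r, 0 <= NG r).
Hypothesis h_le : forall s r, `|h s r| <= NF s * NG r.
Hypothesis mh : forall s, measurable_fun setT (h s).
Hypothesis mprim : forall r, measurable_fun setT (fun s => primitive (h s) r).

Lemma integrableT_Zl (c : R) g : integrableT g -> integrableT (fun r => c * g r).
Proof.
move=> ig; have := @integrableZl _ _ _ mu setT measurableT c _ ig.
by apply: eq_integrable.
Qed.

Lemma primitiveZl (c : R) g x : integrableT g -> primitive (fun r => c * g r) x = c * primitive g x.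
Proof. by move=> ig; rewrite /primitive RintegralZl//; exact: integrableT_sub. Qed.

Lemma primitive_sub_increment_le f g N (c x y : R) : x <= y ->
  integrableT f -> integrableT g -> integrableT N ->
  (forall s, x < s -> s <= y -> `|f s - g s| <= N s * c) ->
  `|(primitive f y - primitive f x) - (primitive g y - primitive g x)| <= (primitive N y - primitive N x) * c.
Proof.
move=> xy if_ ig iN fg.
have ifg : integrableT (fun s => f s - g s) by exact: (integrableB measurableT if_ ig).
have iNc : integrableT (fun s => N s * c).
  by under eq_fun do rewrite mulrC; exact: integrableT_Zl.
rewrite (primitiveB if_ xy) (primitiveB ig xy) (primitiveB iN xy) -RintegralB//; [|exact: integrableT_sub..].
apply: (le_trans (le_normr_Rintegral _ _)) => //; first exact: integrableT_sub.
rewrite -RintegralZr//; last exact: integrableT_sub.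
apply: le_Rintegral => //.
- by apply: integrable_norm; exact: integrableT_sub.
- exact: integrableT_sub.
by move=> s /=; rewrite in_itv/= => /andP[xs sy]; exact: fg.
Qed.

Lemma partial_increment_le s x y : x <= y ->
  `|primitive (h s) y - primitive (h s) x| <= NF s * (primitive NG y - primitive NG x).
Proof.
move=> xy; rewrite mulrBr -!primitiveZl//; apply: primitive_increment_le => //.
exact: integrableT_Zl.
Qed.

Lemma partial_le s x : `|primitive (h s) x| <= NF s * \int[mu]_t NG t.
Proof.
apply: (@le_trans _ _ (NF s * primitive NG x)).
  have ih : integrableT (h s).
    by apply: (integrableT_le (mh s) (integrableT_Zl (NF s) iG)).
  apply: (le_trans (le_normr_Rintegral _ _)) => //; first exact: integrableT_sub.
  rewrite -primitiveZl// /primitive; apply: le_Rintegral => //.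
  - by apply: integrable_norm; exact: integrableT_sub.
  - by apply: (integrableT_sub _ (integrableT_Zl _ iG)).
apply: ler_wpM2l => //.
rewrite /primitive Rintegral_mkcond; apply: le_Rintegral => //.
  by rewrite -restrict_EFin; apply/integrable_restrict => //; rewrite setTI; exact: integrableT_sub.
move=> r _; rewrite patchE; by case: ifP.
Qed.

(** The inner primitive is measurable in s for a fixed upper bound and, by the
    domination of h, continuous in the upper bound; hence its value at a moving
    upper bound is measurable. *)
Lemma measurable_partial_curve (u : R -> R) : measurable_fun setT u ->
  measurable_fun setT (fun s => primitive (h s) (u s)).
Proof.
move=> mu'; apply: (@measurable_caratheodory _ _ _ (fun s => primitive (h s))) => //.
move=> s; apply: continuous_of_primitive_control iG _ => x y; exact: partial_increment_le.
Qed.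

Lemma integrable_partial_curve (u : R -> R) : measurable_fun setT u ->
  integrableT (fun s => primitive (h s) (u s)).
Proof.
move=> mu'; apply: (@integrableT_le _ _ (fun s => (\int[mu]_t NG t) * NF s)).
- exact: measurable_partial_curve.
- exact: integrableT_Zl.
- by move=> s; rewrite mulrC; exact: partial_le.
Qed.

Lemma partial_dist_le s a b x y : x <= a <= y -> x <= b <= y ->
  `|primitive (h s) a - primitive (h s) b| <= NF s * (primitive NG y - primitive NG x).
Proof.
have mono u v : u <= v -> primitive NG u <= primitive NG v by exact: primitive_nondecreasing.
move=> /andP[xa ay] /andP[xb by_].
have [ab|/ltW ba] := leP a b.
  rewrite distrC (le_trans (partial_increment_le _ ab))// ler_wpM2l//.
  by rewrite lerB// mono.
rewrite (le_trans (partial_increment_le _ ba))// ler_wpM2l//.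
by rewrite lerB// mono.
Qed.

(** Over a short interval [x, y], replacing the moving upper bound s + t of the
    inner integral by a fixed one c + t costs a product of two increments,
    which is of second order. This holds for any c in [x, y]. *)
Lemma diagonal_defect_le t c x y : x <= c -> c <= y ->
  `|(primitive (fun s => primitive (h s) (c + t)) y - primitive (fun s => primitive (h s) (c + t)) x)
    - (primitive (fun s => primitive (h s) (s + t)) y - primitive (fun s => primitive (h s) (s + t)) x)|
  <= (primitive NF y - primitive NF x) * (primitive NG (y + t) - primitive NG (x + t)).
Proof.
move=> xc cy.
apply: primitive_sub_increment_le => //; first exact: le_trans cy.
- by apply: integrable_partial_curve; exact: measurable_cst.
- apply: integrable_partial_curve.
  by apply: measurable_funD => //; exact: measurable_cst.
move=> s xs sy; apply: partial_dist_le; rewrite !lerD2r ?xc ?cy//.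
by rewrite sy ltW.
Qed.

End diagonal.

Section diagonal_split.
Variable R : realType.
Local Notation mu := (@lebesgue_measure R).
Local Notation integrableT f := (mu.-integrable setT (EFin \o f)).

(** A form of Fubini's theorem on the two sides of the line r = s + t. The
    integral over {s <= T, r <= T + t} of a kernel h is the sum of its integrals
    below the line (integrating in r first) and above the line (integrating in s
    first), as soon as the two iterated integrals agree on all quadrants. Let H
    be the difference of the two sides as a function of T. When T grows from x
    to y, one quadrant is enlarged in each variable in turn, and H changes by
    two defects as in diagonal_defect_le, hence by at most
    2 a b <= (a + b)^2 with a and b the increments of the primitives of NF and
    NG. So H is constant, and it vanishes where NF does. *)
Lemma diagonal_split (h : R -> R -> R) (NF NG : R -> R) (S T t : R) :
  integrableT NF -> integrableT NG ->
  (forall s, 0 <= NF s) -> (forall r, 0 <= NG r) ->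
  (forall s r, `|h s r| <= NF s * NG r) ->
  (forall s, measurable_fun setT (h s)) ->
  (forall r, measurable_fun setT (h^~ r)) ->
  (forall r, measurable_fun setT (fun s => primitive (h s) r)) ->
  (forall s, measurable_fun setT (fun r => primitive (h^~ r) s)) ->
  (forall s r, primitive (fun s' => primitive (h s') r) s = primitive (fun r' => primitive (h^~ r') s) r) ->
  S <= T -> (forall s, s <= S -> NF s = 0) ->
  primitive (fun s => primitive (h s) (s + t)) T + primitive (fun r => primitive (h^~ r) (r - t)) (T + t)
  = primitive (fun s => primitive (h s) (T + t)) T.
Proof.
move=> iF iG F0 G0 hle mh1 mh2 mp1 mp2 hC ST FS.
have hle' r s : `|h s r| <= NG r * NF s by rewrite mulrC.
pose H x := primitive (fun s => primitive (h s) (x + t)) x -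
  primitive (fun s => primitive (h s) (s + t)) x - primitive (fun r => primitive (h^~ r) (r - t)) (x + t).
have h0 s r : s <= S -> h s r = 0.
  by move=> /FS Fs; apply/eqP; rewrite -normr_le0 (le_trans (hle s r))// Fs mul0r.
have HS : H S = 0.
  rewrite /H !primitive_eq0 ?subr0//.
  - by move=> r rS; apply: primitive_eq0 => s sr; apply: h0; lra.
  - by move=> s sS; apply: primitive_eq0 => r _; exact: h0.
  - by move=> s sS; apply: primitive_eq0 => r _; exact: h0.
have HT : H S = H T.
  apply: (@eq_of_square_control _ H (fun x => primitive NF x + primitive NG (x + t))) => //.
    apply: continuous_subspaceT => x.
    apply: cvgD; first exact: primitive_continuous.
    apply: (@continuous_comp _ _ _ (fun x => x + t) (primitive NG)).
      by apply: cvgD; [exact: cvg_id|exact: cvg_cst].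
    exact: primitive_continuous.
  move=> x y _ xy _.
  have xyt : x + t <= y + t by rewrite lerD2r.
  have I1 := diagonal_defect_le iF iG F0 G0 hle mh1 mp1 t xy (lexx y).
  (* The same bound with the roles of s and r exchanged, for the line s = r - t. *)
  have I2 := diagonal_defect_le (h := fun r s => h s r) iG iF G0 F0 hle' mh2 mp2
    (- t) (lexx (x + t)) xyt.
  rewrite !addrK in I2.
  (* I1 starts where I2 ends: at the quadrant with corner (x, y + t). *)
  have C1 := hC x (y + t).
  have C2 := hC x (x + t).
  have a0 : 0 <= primitive NF y - primitive NF x by rewrite subr_ge0; exact: primitive_nondecreasing.
  have b0 : 0 <= primitive NG (y + t) - primitive NG (x + t).
    by rewrite subr_ge0; exact: primitive_nondecreasing.
  rewrite /H; move: I1 I2 a0 b0 C1 C2.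
  move: (primitive NF y) (primitive NF x) (primitive NG (y + t)) (primitive NG (x + t)).
  move: (primitive _ y) (primitive _ x) (primitive _ y) (primitive _ x) => p1 p2 p3 p4.
  move: (primitive _ (y + t)) (primitive _ (x + t)) => p5 p6.
  move: (primitive _ (y + t)) (primitive _ (x + t)) (primitive _ x) => p7 p8 p9.
  move=> f2 f1 g2 g1 I1 I2 a0 b0 p45 p96.
  rewrite (_ : _ - _ - _ = (p3 - p4 - (p1 - p2)) + (p5 - p6 - (p7 - p8))); last first.
    by rewrite p45 p96; ring.
  apply: (le_trans (ler_normD _ _)); apply: (le_trans (lerD I1 I2)).
  rewrite [X in _ <= X ^+ 2](_ : _ = (f2 - f1) + (g2 - g1)); last by ring.
  move: (f2 - f1) (g2 - g1) a0 b0 => a b a0 b0.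
  by rewrite (mulrC b) sqrrD mulr2n addrAC lerDr addr_ge0// sqr_ge0.
move: HT; rewrite HS /H => /esym/eqP; rewrite -addrA -opprD subr_eq0 => /eqP ->.
by [].
Qed.

End diagonal_split.

(** * The inner product of L^2(O; R^m) on representatives *)

Section L2theory.
Variables (R : realType) (d m : nat) (O : set 'rV[R]_d).
Local Notation nu := (lebesgue_rV R d).
Implicit Types (u v w : field R d m) (a : R).

(** Extending the entries by zero turns integrals over O into integrals over
    the whole space, a measurable domain whatever O is. *)
Definition entry_on u i : 'rV[R]_d -> R := (fun x => u x i 0) \_ O.

Lemma entry_on_lin a u v i x : entry_on (a *: u + v) i x = a * entry_on u i x + entry_on v i x.
Proof.
by rewrite /entry_on !patchE; case: ifP => _; [rewrite !mxE|rewrite mulr0 addr0].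
Qed.

Lemma L2dotE u v : L2dot O u v = \int[nu]_x \sum_i entry_on u i x * entry_on v i x.
Proof.
rewrite /L2dot Rintegral_mkcond; apply: eq_Rintegral => x _.
rewrite patchE /entry_on; case: ifPn => xO.
  by rewrite mxE; apply: eq_bigr => i _; rewrite mxE !patchE xO.
by rewrite big1// => i _; rewrite !patchE (negbTE xO) mul0r.
Qed.

Lemma integrable_dot u v : L2 O u -> L2 O v ->
  nu.-integrable setT (EFin \o (fun x => \sum_i entry_on u i x * entry_on v i x)).
Proof.
move=> Lu Lv.
have := @integrable_sum _ _ R nu setT measurableT _ (index_enum 'I_m) predT
  (fun i x => (entry_on u i x * entry_on v i x)%:E).
rewrite (_ : EFin \o _ = fun x => (\sum_i (entry_on u i x * entry_on v i x)%:E)%E); last first.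
  by apply/funext => x /=; rewrite sumEFin.
apply=> i _; apply/(Lfun1_integrable nu (entry_on u i \* entry_on v i)); exact: (Lfun2_mul_Lfun1 (Lu i) (Lv i)).
Qed.

Lemma L2_lin a u v : L2 O u -> L2 O v -> L2 O (a *: u + v).
Proof.
move=> Lu Lv i.
rewrite (_ : _ \_ O = (a \o* entry_on u i) \+ entry_on v i); last first.
  by apply/funext => x; rewrite [LHS]entry_on_lin /= mulrC.
apply: (Lfun_addr_closed nu (lee1n 2)).2; last exact: (Lv i).
by apply: Lfun_scale; [rewrite ler1n|exact: (Lu i)].
Qed.

Lemma L2_0 : L2 O (0 : field R d m).
Proof.
move=> i; rewrite (_ : _ \_ O = cst 0); last first.
  by apply/funext => x; rewrite patchE; case: ifP => //; rewrite mxE.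
exact: (Lfun_addr_closed nu (lee1n 2)).1.
Qed.

Lemma L2dotC u v : L2dot O u v = L2dot O v u.
Proof.
rewrite !L2dotE; apply: eq_Rintegral => x _; apply: eq_bigr => i _.
exact: mulrC.
Qed.

Lemma L2dot_lin a u v w : L2 O u -> L2 O v -> L2 O w ->
  L2dot O (a *: u + v) w = a * L2dot O u w + L2dot O v w.
Proof.
move=> Lu Lv Lw; rewrite !L2dotE -RintegralZl//; last exact: integrable_dot.
rewrite -RintegralD//; last 2 first.
- have := @integrableZl _ _ _ nu setT measurableT a _ (integrable_dot Lu Lw).
  by apply: eq_integrable => // x _ /=; rewrite EFinM.
- exact: integrable_dot.
apply: eq_Rintegral => x _; rewrite mulr_sumr -big_split; apply: eq_bigr => i _ /=.
by rewrite entry_on_lin mulrDl mulrA.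
Qed.

Lemma L2dot_linr a u v w : L2 O u -> L2 O v -> L2 O w ->
  L2dot O w (a *: u + v) = a * L2dot O w u + L2dot O w v.
Proof. by move=> *; rewrite L2dotC L2dot_lin// !(L2dotC w). Qed.

Lemma L2dot_ge0 u : 0 <= L2dot O u u.
Proof.
rewrite L2dotE; apply: Rintegral_ge0 => x _; apply: sumr_ge0 => i _.
by rewrite -expr2 sqr_ge0.
Qed.

Lemma L2dot0 w : L2dot O 0 w = 0.
Proof.
rewrite L2dotE (@eq_Rintegral _ _ _ _ _ (cst 0)) ?Rintegral_cst ?mul0r// => x _.
by rewrite big1// => i _; rewrite /entry_on patchE mxE if_same mul0r.
Qed.

Lemma L2dot_cauchy_schwarz u v : L2 O u -> L2 O v ->
  `|L2dot O u v| <= L2norm O u * L2norm O v.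
Proof.
move=> Lu Lv; rewrite /L2norm -sqrtrM ?L2dot_ge0// -sqrtr_sqr.
apply: ler_wsqrtr.
have Q a b : 0 <= a ^+ 2 * L2dot O u u + a * b * L2dot O u v *+ 2 + b ^+ 2 * L2dot O v v.
  have L1 : L2 O (b *: v + 0) by apply: L2_lin => //; exact: L2_0.
  have := L2dot_ge0 (a *: u + (b *: v + 0)).
  rewrite L2dot_lin//; last exact: L2_lin.
  rewrite !L2dot_linr//; try exact: L2_0.
  rewrite !L2dot_lin//; try exact: L2_0.
  rewrite (L2dotC v u) (L2dotC u 0) (L2dotC v 0) !L2dot0.
  by move=> /le_trans; apply; rewrite le_eqVlt; apply/orP; left; apply/eqP; ring.
move: (L2dot_ge0 u) (L2dot_ge0 v) Q.
move: (L2dot O u u) (L2dot O v v) (L2dot O u v) => A C B A0 C0 Q.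
(* Q is evaluated at (- B, A), where its value is A (A C - B^2). This is void
   when A = 0, where (- (C + 1), B) gives the value - B^2 (C + 2) instead. *)
have [A1|A1] := eqVneq A 0.
  have := Q (- (C + 1)) B; rewrite A1.
  have B2 := sqr_ge0 B.
  rewrite mul0r mulr0 add0r => H.
  have : 0 <= - B ^+ 2 * (C + 2) by apply: le_trans H _; rewrite le_eqVlt; apply/orP; left; apply/eqP; ring.
  nra.
have Ap : 0 < A by rewrite lt_def A1.
have := Q (- B) A.
rewrite (_ : _ + _ = A * (A * C - B ^+ 2)); last by ring.
by rewrite pmulr_rge0// subr_ge0.
Qed.

Lemma L2dot_eq0l u v : L2 O u -> L2 O v -> L2dot O u u = 0 -> L2dot O u v = 0.
Proof.
move=> Lu Lv u0; apply/eqP; rewrite -normr_le0 (le_trans (L2dot_cauchy_schwarz Lu Lv))//.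
by rewrite /L2norm u0 sqrtr0 mul0r.
Qed.

Lemma L2dot_eqr u v w : L2 O u -> L2 O v -> L2 O w -> L2eq O u v ->
  L2dot O w u = L2dot O w v.
Proof.
move=> Lu Lv Lw uv; rewrite !L2dotE; congr fine.
apply: ae_eq_integral => //.
- exact: (measurable_int _ (integrable_dot Lw Lu)).
- exact: (measurable_int _ (integrable_dot Lw Lv)).
apply: filterS uv => x uv _ /=; congr (_%:E); apply: eq_bigr => i _.
rewrite /entry_on ![((fun _ => _) \_ O) x]patchE; case: ifPn => // /set_mem/uv ->//.
Qed.

(** The integral of the nonnegative sum of squares vanishes only if this sum
    vanishes almost everywhere. *)
Lemma L2dot_self_eq0 u : L2 O u -> L2dot O u u = 0 -> L2eq O u 0.
Proof.
move=> Lu u0.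
have i0 := integrable_dot Lu Lu.
have e0 x : (0 <= (\sum_i entry_on u i x * entry_on u i x)%:E)%E.
  by rewrite lee_fin; apply: sumr_ge0 => i _; rewrite -expr2 sqr_ge0.
have : (\int[nu]_x `|(\sum_i entry_on u i x * entry_on u i x)%:E| = 0)%E.
  under eq_integral do rewrite gee0_abs//.
  rewrite -[LHS]fineK; last exact: integrable_fin_num i0.
  by move: u0; rewrite L2dotE /Rintegral => ->.
move/(ae_eq_integral_abs nu measurableT (measurable_int _ i0)).1.
apply: filterS => x /(_ I) /= [] /eqP.
rewrite psumr_eq0; last by move=> i _; rewrite -expr2 sqr_ge0.
move=> /allP H xO; apply/matrixP => i j; rewrite ord1 mxE.
have := H i (mem_index_enum i); rewrite /= -expr2 sqrf_eq0 /entry_on patchE.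
by rewrite mem_set// => /eqP.
Qed.

End L2theory.

(** * The norm of a force as a function of time *)

Section force.
Variables (R : realType) (d m : nat) (O : set 'rV[R]_d).
Local Notation nu := (lebesgue_rV R d).
Local Notation mu := (@lebesgue_measure R).

(** The squared norm of f s is the inner integral of a jointly measurable function
    on (-ts, ts) x O, so Tonelli's theorem makes it measurable and integrable in
    s. Since f has bounded support in time, the norm itself is integrable:
    a <= 1 + a^2. *)
Lemma force_norm_integrable ts (f : R -> field R d m) : is_force O ts f ->
  mu.-integrable setT (EFin \o (fun s => L2norm O (f s))).
Proof.
move=> [fL2 fslice f0].
pose k i (p : R * 'rV[R]_d) := entry_on O (f p.1) i p.2.
have kE i : k i = (fun p => f p.1 p.2 i 0) \_ (`]- ts, ts[ `*` O).
  apply/funext => -[s x]; rewrite /k /entry_on !patchE /=.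
  have -> : ((s, x) \in `]- ts, ts[ `*` O) = (- ts < s < ts) && (x \in O).
    apply/idP/andP => [|[]].
      by move=> /set_mem[/= sI /mem_set xO]; rewrite in_itv/= in sI.
    by move=> sI /set_mem xO; rewrite inE; split.
  have [//|sI] := boolP (- ts < s < ts) => /=.
  by rewrite f0 ?mxE ?if_same//; exact/negP.
pose G p := \sum_i k i p * k i p.
have Lk i : k i \in Lfun (mu \x nu)%E 2%:E by rewrite kE; exact: fL2.
have iG : (mu \x nu)%E.-integrable setT (EFin \o G).
  have := @integrable_sum _ _ R (mu \x nu)%E setT measurableT _ (index_enum 'I_m) predT
    (fun i p => (k i p * k i p)%:E).
  rewrite (_ : EFin \o _ = fun x => (\sum_i (k i x * k i x)%:E)%E); last first.
    by apply/funext => x /=; rewrite sumEFin.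
  apply=> i _; apply/(Lfun1_integrable (mu \x nu)%E (k i \* k i)).
  exact: (Lfun2_mul_Lfun1 (Lk i) (Lk i)).
have G0 p : (0 <= (G p)%:E)%E.
  by rewrite lee_fin; apply: sumr_ge0 => i _; rewrite -expr2 sqr_ge0.
have mG : measurable_fun setT (EFin \o G) := measurable_int _ iG.
have FE s : (L2dot O (f s) (f s))%:E = fubini_F nu (EFin \o G) s.
  rewrite L2dotE /Rintegral fineK//.
  exact: (integrable_fin_num measurableT (integrable_dot (fslice s) (fslice s))).
have mF := measurable_fun_fubini_tonelli_F (m2 := nu) _ mG G0.
have mN2 : measurable_fun setT (fun s => L2dot O (f s) (f s)).
  by apply/measurable_EFinP; rewrite (_ : _ \o _ = fubini_F nu (EFin \o G)) //; apply/funext => s; exact: FE.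
have iN2 : mu.-integrable setT (EFin \o (fun s => L2dot O (f s) (f s))).
  apply/integrableP; split; first exact/measurable_EFinP.
  move/integrableP : (iG) => [_].
  have -> : (\int[mu \x nu]_x `|(EFin \o G) x| = \int[mu]_s fubini_F nu (EFin \o G) s)%E.
    rewrite -[RHS](fubini_tonelli1 (m1 := mu) (m2 := nu) _ mG G0).
    apply: eq_integral => p _.
    exact: (gee0_abs (G0 p)).
  apply: le_lt_trans; rewrite le_eqVlt; apply/orP; left; apply/eqP.
  by apply: eq_integral => s _; rewrite /= ger0_norm ?L2dot_ge0// FE.
have mN : measurable_fun setT (fun s => L2norm O (f s)).
  apply: (measurableT_comp (f := @Num.sqrt R) _ mN2).
  apply: continuous_measurable_fun.
  exact: sqrt_continuous.
have i1 : mu.-integrable setT (EFin \o \1_(`[- ts, ts]%classic)).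
  exact: integrable_indic_itv.
apply: (@integrableT_le _ _ (fun s => \1_(`[- ts, ts]%classic) s + L2dot O (f s) (f s))) => //.
  exact: (integrableD measurableT i1 iN2).
move=> s; rewrite ger0_norm ?sqrtr_ge0// indicE.
have [sI|sI] := boolP (s \in `[- ts, ts]%classic).
  have n0 := sqrtr_ge0 (L2dot O (f s) (f s)).
  have : L2norm O (f s) ^+ 2 = L2dot O (f s) (f s) by rewrite sqr_sqrtr// L2dot_ge0.
  rewrite -/(L2norm O (f s)) in n0 *; move=> <-; rewrite -[true%:R]/(1 : R).
  by move: (L2norm O (f s)) n0 => N N0; have := sqr_ge0 (N - 1); nra.
rewrite f0; last first.
  by move=> sJ; move/negP: sI; apply; rewrite inE/= in_itv/=; case/andP: sJ => /ltW-> /ltW->.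
by rewrite /L2norm L2dot0 sqrtr0 addr0 ler0n.
Qed.
End force.

(** * Duhamel's formula and the array response *)

Lemma primitive_support (R : realType) (g : R -> R) c T : c <= T ->
  (forall s, ~ (- c < s < c) -> g s = 0) ->
  primitive g T = \int[@lebesgue_measure R]_(s in `[- c, c]) g s.
Proof.
move=> cT g0; rewrite /primitive Rintegral_mkcond [RHS]Rintegral_mkcond.
apply: eq_Rintegral => s _; rewrite !patchE !mem_setE !in_itv/=.
have [/andP[s1 s2]|/negP/g0 ->] := boolP (- c < s < c); last by rewrite !if_same.
by rewrite (ltW s1) (ltW s2) (le_trans (ltW s2) cT).
Qed.

Section waves.
Variables (R : realType) (d m : nat) (O : set 'rV[R]_d).
Variables (U : R -> field R d m -> field R d m) (ts : R).
Hypothesis (gU : unitary_group O U) (ts_gt0 : 0 < ts).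
Local Notation mu := (@lebesgue_measure R).
Local Notation integrableT f := (mu.-integrable setT (EFin \o f)).
Implicit Types (u v w : field R d m).

Lemma L2_group t u : L2 O u -> L2 O (U t u).
Proof. by case: gU => + _ _ _ _; exact. Qed.

Lemma group_isometry t u v : L2 O u -> L2 O v -> L2dot O (U t u) (U t v) = L2dot O u v.
Proof. by case: gU => _ _ _ + _; exact. Qed.

(** U t = U s U (t - s) almost everywhere, and U s is an isometry. *)
Lemma group_adjoint s t u w : L2 O u -> L2 O w ->
  L2dot O (U s w) (U t u) = L2dot O w (U (t - s) u).
Proof.
move=> Lu Lw; rewrite -(group_isometry s Lw (L2_group (t - s) Lu)).
case: gU => _ _ /(_ _ Lu)[_ /(_ s (t - s))] + _ _; rewrite subrKC => e.
by apply: L2dot_eqr e; do ?apply: L2_group.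
Qed.

Lemma group0_dot u w : L2 O u -> L2 O w -> L2dot O w (U 0 u) = L2dot O w u.
Proof.
move=> Lu Lw; case: (gU) => _ _ /(_ _ Lu)[e _] _ _.
by apply: L2dot_eqr e => //; exact: L2_group.
Qed.

Lemma group_adjointl s u w : L2 O u -> L2 O w ->
  L2dot O w (U s u) = L2dot O (U (- s) w) u.
Proof.
move=> Lu Lw; rewrite -(group0_dot Lu (L2_group _ Lw)) group_adjoint//.
by rewrite sub0r opprK.
Qed.

Lemma group_zero_dot t w : L2 O w -> L2dot O w (U t 0) = 0.
Proof.
move=> Lw; have L0 := @L2_0 R d m O.
rewrite L2dotC L2dot_eq0l//; first exact: L2_group.
by rewrite group_isometry// L2dot0.
Qed.

Section one_wave.
Variables (f psi : R -> field R d m).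
Hypotheses (hf : is_force O ts f) (hpsi : is_wave_field O U ts f psi).

Lemma force_L2 t : L2 O (f t).
Proof. by case: hf. Qed.

Lemma force_eq0 t : ~ (- ts < t < ts) -> f t = 0.
Proof. by case: hf => _ _; exact. Qed.

Lemma wave_L2 t : L2 O (psi t).
Proof.
by have [/hpsi.1[]|/hpsi.2[]] := ltP t (- ts).
Qed.

(** Duhamel's formula on [- ts, ts], tested against U (ts - c) u, gives the
    integrability on this interval; the force vanishes outside. *)
Lemma duhamel_integrable c u : L2 O u ->
  integrableT (fun r => L2dot O u (U (c - r) (f r))).
Proof.
move=> Lu; have t2 : - ts <= ts by have := ts_gt0; lra.
have [_ /(_ (U (ts - c) u) (L2_group _ Lu))[i _]] := hpsi.2 _ t2.
have mI : measurable (`[- ts, ts]%classic : set (measurableTypeR R)).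
  exact: measurable_itv.
have := (@integrable_mkcond _ (measurableTypeR R) R mu _ _ mI).1 i.
apply: eq_integrable => // r _ /=; rewrite patchE mem_setE in_itv/=.
have Lf := force_L2 r.
case: ifPn => [_|rI].
  by rewrite group_adjoint//; congr (L2dot _ _ (U _ _))%:E; ring.
rewrite force_eq0 ?group_zero_dot//.
by move=> /andP[r1 r2]; rewrite (ltW r1) (ltW r2) in rI.
Qed.

(** Duhamel's formula, transported by the group to an arbitrary reference time c:
    the integrand no longer depends on rho, only the domain does. *)
Lemma duhamel c rho u : L2 O u ->
  primitive (fun r => L2dot O u (U (c - r) (f r))) rho
  = L2dot O u (U (c - rho) (psi rho)).
Proof.
move=> Lu; have Lp := wave_L2 rho.
rewrite group_adjointl// opprB.
have [lt|ge] := ltP rho (- ts).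
  rewrite (L2dot_eqr Lp (@L2_0 _ _ _ O) (L2_group _ Lu) (hpsi.1 _ lt).2).
  rewrite L2dotC L2dot0; apply: primitive_eq0 => r rle.
  by rewrite force_eq0 ?group_zero_dot// => /andP[? ?]; lra.
have [_ /(_ (U (rho - c) u) (L2_group _ Lu))[_ ->]] := hpsi.2 _ ge.
rewrite /primitive Rintegral_mkcond [RHS]Rintegral_mkcond.
apply: eq_Rintegral => r _; rewrite !patchE !mem_setE !in_itv/=.
have [rge|rlt] /= := leP (- ts) r; last first.
  by rewrite force_eq0 ?group_zero_dot ?if_same// => /andP[? ?]; lra.
case: ifP => // _; rewrite group_adjoint//; last exact: force_L2.
by congr (L2dot _ _ (U _ _)); ring.
Qed.

(** After the time ts the force is off, so that both sides are the same integral
    of Duhamel's formula. *)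
Lemma propagation rho delta u : L2 O u -> ts <= rho -> 0 <= delta ->
  L2dot O u (psi (rho + delta)) = L2dot O u (U delta (psi rho)).
Proof.
move=> Lu tr d0.
have := duhamel (rho + delta) (rho + delta) Lu.
rewrite subrr group0_dot//; last exact: wave_L2.
move=> <-; have := duhamel (rho + delta) rho Lu; rewrite addrAC subrr add0r => <-.
apply/eqP; rewrite -subr_eq0 primitiveB ?lerDl//; last exact: duhamel_integrable.
rewrite (@eq_Rintegral _ _ _ _ _ (cst 0)) ?Rintegral_cst ?mul0r//.
move=> r; rewrite inE/= in_itv/= => /andP[r1 r2].
by rewrite force_eq0 ?group_zero_dot// => /andP[? ?]; lra.
Qed.

End one_wave.

Section two_waves.
Variables (f1 psi1 f2 psi2 : R -> field R d m).
Hypotheses (hf1 : is_force O ts f1) (hpsi1 : is_wave_field O U ts f1 psi1).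
Hypotheses (hf2 : is_force O ts f2) (hpsi2 : is_wave_field O U ts f2 psi2).

(** The array response at the two opposite times t and - t adds up to a single
    inner product of wave fields. Put h s r = <f1 s, U (t + s - r) (f2 r)>. By
    Duhamel's formula, the first integral is that of h over r <= s + t and,
    because the adjoint of U a is U (- a), the second one is that of h over
    s <= r - t; the inner product on the right is the integral of h over the
    whole quadrant. Both iterated integrals over any quadrant are equal to
    <psi1 s, U (t + s - r) (psi2 r)>, so that diagonal_split applies. *)
Lemma pairing_identity T t : ts <= T -> 0 <= t ->
  \int[mu]_(s in `[- ts, ts]) L2dot O (f1 (- s)) (psi2 (t - s)) +
  \int[mu]_(s in `[- ts, ts]) L2dot O (f2 (- s)) (psi1 (- t - s))
  = L2dot O (psi1 T) (psi2 (t + T)).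
Proof.
move=> tsT t0.
have Lf1 := force_L2 hf1; have Lf2 := force_L2 hf2.
have Lp1 := wave_L2 hpsi1; have Lp2 := wave_L2 hpsi2.
pose h s r := L2dot O (f1 s) (U (t + s - r) (f2 r)).
have hE s r : h s r = L2dot O (f2 r) (U (r - t - s) (f1 s)).
  rewrite /h group_adjointl// L2dotC; congr (L2dot _ _ (U _ _)); ring.
have pF s r : primitive (h s) r = L2dot O (f1 s) (U (t + s - r) (psi2 r)).
  exact: (duhamel hf2 hpsi2 (t + s) r (Lf1 s)).
have pG s r : primitive (h^~ r) s = L2dot O (f2 r) (U (r - t - s) (psi1 s)).
  rewrite -(duhamel hf1 hpsi1 (r - t) s (Lf2 r)); apply: eq_primitive => s' _; exact: hE.
have pF' s r : primitive (h s) r = L2dot O (psi2 r) (U (r - t - s) (f1 s)).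
  rewrite pF group_adjointl// L2dotC; congr (L2dot _ _ (U _ _)); ring.
have pG' s r : primitive (h^~ r) s = L2dot O (psi1 s) (U (t + s - r) (f2 r)).
  rewrite pG group_adjointl// L2dotC; congr (L2dot _ _ (U _ _)); ring.
have iF := force_norm_integrable hf1; have iG := force_norm_integrable hf2.
have F0 s : 0 <= L2norm O (f1 s) by exact: sqrtr_ge0.
have G0 s : 0 <= L2norm O (f2 s) by exact: sqrtr_ge0.
have normU s u : L2 O u -> L2norm O (U s u) = L2norm O u.
  by move=> Lu; rewrite /L2norm group_isometry.
have hle s r : `|h s r| <= L2norm O (f1 s) * L2norm O (f2 r).
  rewrite /h (le_trans (L2dot_cauchy_schwarz _ _))//; first exact: L2_group.
  by rewrite normU.
have hle' r s : `|h s r| <= L2norm O (f2 r) * L2norm O (f1 s) by rewrite mulrC.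
have meas (g : R -> R) : integrableT g -> measurable_fun setT g.
  by move=> /measurable_int/measurable_EFinP.
have mh1 s : measurable_fun setT (h s).
  by apply: meas; exact: (duhamel_integrable hf2 hpsi2).
have mh2 r : measurable_fun setT (h^~ r).
  rewrite (_ : h^~ r = fun s => L2dot O (f2 r) (U (r - t - s) (f1 s))); last first.
    by apply/funext => s; exact: hE.
  by apply: meas; exact: (duhamel_integrable hf1 hpsi1).
have mp1 r : measurable_fun setT (fun s => primitive (h s) r).
  under eq_fun do rewrite pF'.
  by apply: meas; exact: (duhamel_integrable hf1 hpsi1).
have mp2 s : measurable_fun setT (fun r => primitive (h^~ r) s).
  under eq_fun do rewrite pG'.
  by apply: meas; exact: (duhamel_integrable hf2 hpsi2).
have hC s r : primitive (fun s' => primitive (h s') r) s = primitive (fun r' => primitive (h^~ r') s) r.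
  under [in LHS]eq_fun do rewrite pF'.
  under [in RHS]eq_fun do rewrite pG'.
  rewrite (duhamel hf1 hpsi1 (r - t) s (Lp2 r)) (duhamel hf2 hpsi2 (t + s) r (Lp1 s)).
  rewrite group_adjointl// L2dotC.
  congr (L2dot _ _ (U _ _)); ring.
have ST : - ts <= T by have := ts_gt0; lra.
have FS s : s <= - ts -> L2norm O (f1 s) = 0.
  move=> sle; rewrite (force_eq0 hf1) /L2norm ?L2dot0 ?sqrtr0//.
  by move=> /andP[? ?]; lra.
have m1 : measurable_fun setT (fun s : R => s + t).
  by apply: measurable_funD => //; exact: measurable_cst.
have m2 : measurable_fun setT (fun s : R => s - t).
  by apply: measurable_funB => //; exact: measurable_cst.
have i1 := integrable_partial_curve iF iG F0 G0 hle mh1 mp1 m1.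
have i2 := integrable_partial_curve (h := fun r s => h s r) iG iF G0 F0 hle' mh2 mp2 m2.
have e1 : (fun s => primitive (h s) (s + t)) = fun s => L2dot O (f1 s) (psi2 (s + t)).
  by apply/funext => s; rewrite pF (addrC t) subrr group0_dot.
have e2 : (fun r => primitive (h^~ r) (r - t)) = fun r => L2dot O (f2 r) (psi1 (r - t)).
  by apply/funext => r; rewrite pG subrr group0_dot.
have full : primitive (fun s => primitive (h s) (T + t)) T = L2dot O (psi1 T) (psi2 (T + t)).
  transitivity (primitive (fun s => L2dot O (psi2 (T + t)) (U (T + t - t - s) (f1 s))) T).
    by apply: eq_primitive => s _; exact: pF'.
  rewrite (duhamel hf1 hpsi1 (T + t - t) T (Lp2 (T + t))).
  by rewrite addrK subrr group0_dot// L2dotC.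
have split : primitive (fun s => L2dot O (f1 s) (psi2 (s + t))) T +
    primitive (fun r => L2dot O (f2 r) (psi1 (r - t))) (T + t)
    = L2dot O (psi1 T) (psi2 (T + t)).
  rewrite -e1 -e2 -full.
  exact: (diagonal_split t iF iG F0 G0 hle mh1 mh2 mp1 mp2 hC ST FS).
rewrite e1 in i1; rewrite e2 in i2.
rewrite (addrC t T) -split.
have z1 s : ~ (- ts < s < ts) -> L2dot O (f1 s) (psi2 (s + t)) = 0.
  by move=> /(force_eq0 hf1) ->; rewrite L2dot0.
have z2 s : ~ (- ts < s < ts) -> L2dot O (f2 s) (psi1 (s - t)) = 0.
  by move=> /(force_eq0 hf2) ->; rewrite L2dot0.
have tsTt : ts <= T + t by rewrite (le_trans tsT)// lerDl.
rewrite (primitive_support tsT z1) (primitive_support tsTt z2).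
rewrite -(Rintegral_reflect ts (meas _ i1) i1) -(Rintegral_reflect ts (meas _ i2) i2).
apply: (f_equal2 +%R); apply: eq_Rintegral => s _ /=.
  by rewrite (addrC t).
by rewrite (addrC (- t)).
Qed.

End two_waves.
End waves.

(** * Blocks of square matrices *)

Lemma sym_pos_def_unit (R : realType) n (A : 'M[R]_n) : sym_pos_def A -> A \in unitmx.
Proof.
move=> [_ Apos]; rewrite unitmxE unitfE; apply/negP => /det0P [v v0 vA].
have := Apos v^T; rewrite trmxK vA mul0mx mxE ltxx => H.
suff: false by []; apply: H; apply: contraNneq v0 => /(congr1 trmx).
by rewrite trmxK trmx0 => ->.
Qed.

Section blocks.
Variables (R : realType) (nt nE : nat).
Local Notation N := (\sum_(j < nt) nE)%N.
Implicit Types (A B : 'M[R]_N) (l j k : 'I_nt).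

(** The j-th block of columns of the identity: the block (l, j) of A is the
    compression (block_id l)^T *m A *m block_id j, so that block computations
    become computations with ordinary products. *)
Definition block_id j : 'M[R]_(N, nE) := @submxrow R nt (fun=> nE) N 1%:M j.

Lemma block_idE j i b : block_id j i b = (i == @tagnat.Rank nt (fun=> nE) j b)%:R.
Proof. by rewrite !mxE. Qed.

Lemma block_idT_mul p (A : 'M[R]_(N, p)) l :
  (block_id l)^T *m A = @submxcol R nt (fun=> nE) p A l.
Proof.
rewrite tr_submxrow trmx1.
by rewrite submxcol_mul mul1mx.
Qed.

Lemma mul_block_id p (A : 'M[R]_(p, N)) j :
  A *m block_id j = @submxrow R nt (fun=> nE) p A j.
Proof. by rewrite mul_submxrow mulmx1. Qed.

Lemma blockE A l j : block A l j = (block_id l)^T *m A *m block_id j.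
Proof.
rewrite -mulmxA mul_block_id block_idT_mul.
by apply/matrixP => a b; rewrite !mxE.
Qed.

Lemma block_id_orth l j :
  (block_id l)^T *m block_id j = if l == j then 1%:M else 0.
Proof.
apply/matrixP => a b; rewrite block_idT_mul mxE block_idE.
have := @tagnat.eq_Rank nt (fun=> nE) l j a b; rewrite !val_eqE => ->.
by case: eqP; rewrite !mxE.
Qed.

Lemma block_id_sum : \sum_j block_id j *m (block_id j)^T = 1%:M :> 'M[R]_N.
Proof.
have := @submxrowK R nt (fun=> nE) N 1%:M.
have := @submxcolK R nt (fun=> nE) N 1%:M.
move=> Hc Hr.
transitivity ((\mxrow_j block_id j) *m (\mxcol_j (block_id j)^T)).
  by rewrite mul_mxrow_mxcol.
have E j : (block_id j)^T = @submxcol R nt (fun=> nE) N 1%:M j.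
  by rewrite tr_submxrow trmx1.
by rewrite [X in X *m _]Hr mul1mx -[RHS]Hc; apply: eq_mxcol; exact: E.
Qed.

Lemma blockM A B l j : block (A *m B) l j = \sum_k block A l k *m block B k j.
Proof.
rewrite blockE -[A in LHS]mulmx1 -block_id_sum mulmx_sumr mulmx_suml mulmx_sumr mulmx_suml.
by apply: eq_bigr => k _; rewrite !blockE !mulmxA.
Qed.

Lemma block1 l j : block 1%:M l j = if l == j then 1%:M else 0 :> 'M[R]_nE.
Proof. by rewrite blockE mulmx1 block_id_orth. Qed.

Lemma eq_block_col A B j k : (forall l, block A l j = block B l k) ->
  A *m block_id j = B *m block_id k.
Proof.
move=> AB; rewrite -[LHS]mul1mx -[RHS]mul1mx -block_id_sum !mulmx_suml.
by apply: eq_bigr => l _; have := AB l; rewrite !blockE -!mulmxA => ->.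
Qed.

Lemma pid_block_id (nt_gt0 : (0 < nt)%N) : pid_mx nE = block_id (Ordinal nt_gt0).
Proof.
apply/matrixP => i b; rewrite block_idE mxE.
have E : @tagnat.Rank nt (fun=> nE) (Ordinal nt_gt0) b = b :> nat.
  by rewrite tagnat.RankEsum big_pred0.
have -> : (i == @tagnat.Rank nt (fun=> nE) (Ordinal nt_gt0) b) = (i == b :> nat).
  apply/eqP/eqP => [->|ib]; first exact: E.
  by apply: val_inj; exact: etrans ib (esym E).
by case: eqP => //= ->; rewrite ltn_ord.
Qed.

Definition block_upper A := forall l j, (j < l)%N -> block A l j = 0.

(** Block back substitution, by descending induction on the block row l: in
    A *m X = 1, the row l of the product only involves A l l *m X l j and rows
    of X below l, already known to vanish left of the diagonal. On the diagonal,
    this exhibits the inverse of A l l, which then cancels it elsewhere. *)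
Lemma block_upper_inv A : block_upper A -> A \in unitmx ->
  block_upper (invmx A) /\
  forall l, block A l l *m block (invmx A) l l = 1%:M.
Proof.
move=> Aup Au; set X := invmx A.
have AX l j : \sum_k block A l k *m block X k j = if l == j then 1%:M else 0.
  by rewrite -blockM mulmxV// block1.
suff main n : forall l, (nt - l <= n)%N ->
    (forall j, (j < l)%N -> block X l j = 0) /\ block A l l *m block X l l = 1%:M.
  by split => [l j|l]; [exact: (main nt l (leq_subr _ _)).1|exact: (main nt l (leq_subr _ _)).2].
elim: n => [l|n IH l ln].
  by rewrite leqn0 subn_eq0 leqNgt ltn_ord.
have diag j : (j <= l)%N -> block A l l *m block X l j = if l == j then 1%:M else 0.
  move=> jl; rewrite -AX (bigD1 l)//= big1 ?addr0// => k kl.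
  have [kltl|lltk] : (k < l)%N \/ (l < k)%N by apply/orP; rewrite -neq_ltn.
    by rewrite Aup// mul0mx.
  rewrite (IH k _).1 ?mulmx0//; last exact: leq_ltn_trans lltk.
  by rewrite -ltnS (leq_trans _ ln)// ltn_sub2l// ltn_ord.
have ll := diag l (leqnn l); rewrite eqxx in ll.
split=> // j jl; have := diag j (ltnW jl).
case: eqP => [lj|_ /(congr1 (mulmx (block X l l)))]; first by rewrite lj ltnn in jl.
by rewrite mulmxA (mulmx1C ll) mul1mx mulmx0.
Qed.

End blocks.

(** * The algebra of the reduced order model *)

Section rom_algebra.
Variables (R : realType) (nt nE : nat).
Local Notation N := (\sum_(j < nt) nE)%N.
Hypotheses (nt_gt0 : (0 < nt)%N) (nE_gt0 : (0 < nE)%N).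
Variables (M S Rm : 'M[R]_N).
Hypotheses (Mpos : sym_pos_def M) (Rup : block_upper Rm) (RtR : Rm^T *m Rm = M).
(** This holds because the propagator maps each snapshot to the next one. *)
Hypothesis shift : forall l j k : 'I_nt, k = j.+1 :> nat -> block S l j = block M l k.

Lemma factor_unit : Rm \in unitmx.
Proof.
have := sym_pos_def_unit Mpos; rewrite -RtR !unitmxE det_mulmx.
by rewrite unitrM => /andP[].
Qed.

Definition galerkin_seq (g : nat) : 'M[R]_(N, nE) :=
  iter g (fun X => invmx M *m (S *m X)) (pid_mx nE).

Lemma galerkin_unique g : galerkin M S Rm g -> forall j, g j = galerkin_seq j.
Proof.
move=> [g0 gS]; elim=> [//|j IH].
have := gS j; rewrite -!mulmxA => /(can_inj (mulKmx _)).
rewrite unitmx_tr unitmx_inv factor_unit => /(_ isT) e.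
by rewrite /galerkin_seq iterS -/(galerkin_seq j) -IH -e mulKmx// sym_pos_def_unit.
Qed.

(** As long as the snapshots belong to the approximation space, the Galerkin
    scheme is exact: M maps block_id (j + 1) to where S maps block_id j. *)
Lemma galerkin_seq_lt j (jlt : (j < nt)%N) : galerkin_seq j = block_id R nE (Ordinal jlt).
Proof.
elim: j jlt => [|j IH] jlt; first exact: pid_block_id.
rewrite /galerkin_seq iterS -/(galerkin_seq j) (IH (ltnW jlt)).
rewrite (@eq_block_col _ _ _ S M _ (Ordinal jlt)).
  by rewrite mulKmx// sym_pos_def_unit.
by move=> l; exact: shift.
Qed.

Lemma rom_inner j (jlt : (j < nt)%N) :
  (Rm *m galerkin_seq 0)^T *m (Rm *m galerkin_seq j) =
  block M (Ordinal nt_gt0) (Ordinal jlt).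
Proof.
rewrite (galerkin_seq_lt nt_gt0) (galerkin_seq_lt jlt) blockE -RtR.
by rewrite trmx_mul !mulmxA.
Qed.

Local Notation P := (rom_propagator S Rm).

(** The columns of Rm *m block_id j are the ROM snapshots, which the ROM propagator
    shifts. *)
Lemma propagator_shift (j k : 'I_nt) : k = j.+1 :> nat ->
  P *m Rm *m block_id R nE j = Rm *m block_id R nE k.
Proof.
move=> kj; rewrite /rom_propagator mulmxKV ?factor_unit//.
rewrite -mulmxA (@eq_block_col _ _ _ S M _ k) => [|l]; last exact: shift.
rewrite -RtR !mulmxA -trmx_mul mulmxV ?factor_unit//.
by rewrite trmx1 mul1mx.
Qed.

Lemma propagator_shift_block (l j k : 'I_nt) : k = j.+1 :> nat ->
  block (P *m Rm) l j = block Rm l k.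
Proof. by move=> kj; rewrite !blockE -[LHS]mulmxA (propagator_shift kj) mulmxA. Qed.

(** P = (P Rm) Rm^-1, where P Rm is Rm shifted by one block column and Rm^-1 is
    block upper triangular. Strictly below the diagonal, only the product of two
    diagonal blocks survives, on the first subdiagonal. *)
Lemma propagator_block (l j : 'I_nt) : (j < l)%N ->
  block P l j = if l == j.+1 :> nat
                then block Rm l l *m block (invmx Rm) j j else 0.
Proof.
move=> jl; have [Xup _] := block_upper_inv Rup factor_unit.
rewrite -[P](mulmxK factor_unit) blockM (bigD1 j)//= [X in _ + X]big1 => [|i ij].
  have kP : (j.+1 < nt)%N by exact: leq_ltn_trans jl (ltn_ord l).
  rewrite addr0 (@propagator_shift_block _ _ (Ordinal kP))//.
  case: eqP => [lj|/eqP lj]; first by congr (block _ _ _ *m _); apply: val_inj.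
  by rewrite Rup ?mul0mx//= ltn_neqAle eq_sym lj.
have [ilt|jlt] : (i < j)%N \/ (j < i)%N by apply/orP; rewrite -neq_ltn.
  have kP : (i.+1 < nt)%N by exact: leq_ltn_trans ilt (ltn_ord j).
  by rewrite (@propagator_shift_block _ _ (Ordinal kP))// Rup ?mul0mx//=; exact: leq_ltn_trans ilt jl.
by rewrite Xup// mulmx0.
Qed.

Lemma propagator_hessenberg (l j : 'I_nt) : (j.+1 < l)%N -> block P l j = 0.
Proof.
by move=> jl; rewrite propagator_block ?(ltnW jl)// gtn_eqF.
Qed.

(** Diagonal blocks of Rm and of its inverse are invertible, hence their product
    does not vanish. *)
Lemma propagator_unreduced (l j : 'I_nt) : l = j.+1 :> nat -> block P l j <> 0.
Proof.
move=> lj; rewrite propagator_block ?lj// eqxx => RX0.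
have [_ RX] := block_upper_inv Rup factor_unit.
have Rl0 : block Rm l l = 0.
  by rewrite -[block Rm l l]mulmx1 -(mulmx1C (RX j)) mulmxA RX0 mul0mx.
have := RX l; rewrite Rl0 mul0mx => /matrixP/(_ (Ordinal nE_gt0) (Ordinal nE_gt0)).
by rewrite !mxE eqxx => /esym/eqP; rewrite oner_eq0.
Qed.

End rom_algebra.

(** * Gram matrices of snapshots *)

Section gram.
Variables (R : realType) (d m : nat) (O : set 'rV[R]_d).
Local Notation nu := (lebesgue_rV R d).

Lemma gramE p q (F : 'rV[R]_d -> 'M[R]_(m, p)) (G : 'rV[R]_d -> 'M[R]_(m, q)) a b :
  gram O F G a b = L2dot O (fun x => col a (F x)) (fun x => col b (G x)).
Proof.
rewrite mxE; apply: eq_Rintegral => x _; rewrite !mxE.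
by apply: eq_bigr => i _; rewrite !mxE.
Qed.

Lemma L2dot_sumr (I : Type) (r : seq I) (c : I -> field R d m) (v : I -> R) (u : field R d m) :
  L2 O u -> (forall k, L2 O (c k)) ->
  L2 O (\sum_(k <- r) v k *: c k) /\
  L2dot O u (\sum_(k <- r) v k *: c k) = \sum_(k <- r) v k * L2dot O u (c k).
Proof.
move=> Lu Lc; elim: r => [|k r [L IH]].
  by rewrite !big_nil L2dotC L2dot0; split => //; exact: L2_0.
by rewrite !big_cons; split; [exact: L2_lin|rewrite L2dot_linr// IH].
Qed.

(** The quadratic form of a Gram matrix at v is the squared norm of the linear
    combination of the columns with coefficients v. *)
Lemma gram_sym_pos_def n (F : 'rV[R]_d -> 'M[R]_(m, n)) :
  (forall k, L2 O (fun x => col k (F x))) -> L2_free_columns O F ->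
  sym_pos_def (gram O F F).
Proof.
move=> LF free; split.
  by apply/matrixP => a b; rewrite mxE !gramE L2dotC.
move=> v v0; set c := fun k x => col k (F x).
pose w : field R d m := \sum_k v k 0 *: c k.
have wE x : w x = F x *m v.
  rewrite /w fct_sumE; apply/matrixP => i j; rewrite summxE mxE ord1.
  by apply: eq_bigr => k _; rewrite !mxE mulrC.
have [Lw _] := L2dot_sumr (index_enum 'I_n) (fun k => v k 0) (@L2_0 _ _ _ O) LF.
have quad : (v^T *m gram O F F *m v) 0 0 = L2dot O w w.
  have [_ ->] := L2dot_sumr (index_enum 'I_n) (fun k => v k 0) Lw LF.
  rewrite -mulmxA mxE; apply: eq_bigr => a _; rewrite [v^T _ _]mxE [(_ *m v) _ _]mxE; congr (_ * _).
  rewrite L2dotC.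
  have [_ ->] := L2dot_sumr (index_enum 'I_n) (fun k => v k 0) (LF a) LF.
  by apply: eq_bigr => b _; rewrite gramE mulrC.
rewrite quad lt_def L2dot_ge0 andbT; apply: contra_neq v0 => /(L2dot_self_eq0 Lw) w0.
apply: free; apply: filterS w0 => x xw Ox.
by rewrite -wE; exact: xw.
Qed.

End gram.

Section data.
Variables (R : realType) (nt nE : nat).
Local Notation N := (\sum_(j < nt) nE)%N.
Implicit Type D : 'I_nt.+1 -> 'M[R]_nE.

(** The block at (l, j) of a symmetric block Toeplitz matrix with first row D. *)
Definition lag D (l j : nat) : 'M[R]_nE :=
  if (l <= j)%N then D (inord (j - l)) else (D (inord (l - j)))^T.

Definition mass_of_data D : 'M[R]_N :=
  @mxblock R nt nt (fun=> nE) (fun=> nE) (fun l j => lag D l j).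

Definition stiffness_of_data D : 'M[R]_N :=
  @mxblock R nt nt (fun=> nE) (fun=> nE) (fun l j => lag D l j.+1).

Lemma block_inj (A B : 'M[R]_N) : (forall l j, block A l j = block B l j) -> A = B.
Proof. by move=> AB; apply/mxblockP; exact: AB. Qed.

Lemma block_mass D l j : block (mass_of_data D) l j = lag D l j.
Proof. exact: mxblockK. Qed.

Lemma block_stiffness D l j : block (stiffness_of_data D) l j = lag D l j.+1.
Proof. exact: mxblockK. Qed.

End data.

Section rom_data.
Variables (R : realType) (d m nt nE : nat) (O : set 'rV[R]_d).
Variables (U : R -> field R d m -> field R d m) (E : nE.-tuple (nat * nat)).
Variables (ts tau dt : R) (f psi : nat * nat -> R -> field R d m).
Hypotheses (gU : unitary_group O U) (ts_gt0 : 0 < ts) (ts_tau : ts <= tau) (dt_gt0 : 0 < dt).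
Hypothesis hf : forall e, e \in E -> is_force O ts (f e).
Hypothesis hpsi : forall e, e \in E -> is_wave_field O U ts (f e) (psi e).
Local Notation phi := (snapshot E tau dt psi).
Local Notation Phi := (snapshots E nt tau dt psi).
Local Notation D := (data_matrix O E ts dt f psi).

Lemma col_snapshot j k :
  (fun x => col k (phi j x)) = psi (tnth E k) (j%:R * dt + tau).
Proof. by apply/funext => x; apply/matrixP => i z; rewrite !mxE ord1. Qed.

Lemma col_snapshots (j : 'I_nt) k :
  (fun x => col (@tagnat.Rank nt (fun=> nE) j k) (Phi x)) =
  psi (tnth E k) (j%:R * dt + tau).
Proof.
rewrite -col_snapshot; apply/funext => x.
have /matrixP H := @mxrowK R nt (fun=> nE) m (fun j => phi j x) j.
by apply/matrixP => i z; have := H i k; rewrite !mxE.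
Qed.

Lemma snapshot_L2 k t : L2 O (psi (tnth E k) t).
Proof. exact: (wave_L2 (hpsi (mem_tnth k E))). Qed.

(** The propagator is an isometry, so inner products of snapshots depend on the
    time lag only. *)
Lemma gram_snapshot_lag l i : gram O (phi l) (phi (l + i)%N) = gram O (phi 0) (phi i).
Proof.
have prop k u n : L2 O u -> L2dot O u (psi (tnth E k) ((l + n)%N%:R * dt + tau)) =
    L2dot O u (U (l%:R * dt) (psi (tnth E k) (n%:R * dt + tau))).
  move=> Lu; have e : (l + n)%N%:R * dt + tau = n%:R * dt + tau + l%:R * dt.
    by rewrite natrD; ring.
  rewrite e; apply: (propagation gU ts_gt0 (hf (mem_tnth k E)) (hpsi (mem_tnth k E)) Lu).
    by rewrite (le_trans ts_tau)// lerDr mulr_ge0// ltW.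
  by rewrite mulr_ge0// ltW.
have LU n k t : L2 O (U (n%:R * dt) (psi (tnth E k) t)).
  by apply: (L2_group gU); exact: snapshot_L2.
apply/matrixP => a b; rewrite !gramE !col_snapshot.
rewrite (prop b); last exact: snapshot_L2.
have := prop a _ 0%N (LU l b (i%:R * dt + tau)); rewrite addn0 L2dotC => ->.
rewrite (group_isometry gU _ (snapshot_L2 b _) (snapshot_L2 a _)).
exact: L2dotC.
Qed.

(** The entries of both terms of the data matrix are the two integrals of the
    pairing identity. *)
Lemma data_gram j : D j = gram O (phi 0) (phi j).
Proof.
apply/matrixP => a b; rewrite gramE !col_snapshot mul0r add0r.
have hfa := hf (mem_tnth a E); have hfb := hf (mem_tnth b E).
have hpa := hpsi (mem_tnth a E); have hpb := hpsi (mem_tnth b E).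
have jdt : 0 <= j%:R * dt by rewrite mulr_ge0// ltW.
by rewrite -(pairing_identity gU ts_gt0 hfa hpa hfb hpb ts_tau jdt) !mxE.
Qed.

Lemma gram_tr l j : (gram O (phi l) (phi j))^T = gram O (phi j) (phi l).
Proof. by apply/matrixP => a b; rewrite mxE !gramE L2dotC. Qed.

Lemma gram_lag l j : (l <= nt)%N -> (j <= nt)%N ->
  gram O (phi l) (phi j) = lag (fun i : 'I_nt.+1 => D i) l j.
Proof.
move=> lnt jnt; rewrite /lag; case: leqP => [lj|/ltnW jl].
  rewrite inordK ?ltnS ?(leq_trans (leq_subr _ _))//.
  by rewrite data_gram -(gram_snapshot_lag l) subnKC.
rewrite inordK ?ltnS ?(leq_trans (leq_subr _ _))//.
by rewrite data_gram -(gram_snapshot_lag j) subnKC// gram_tr.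
Qed.

Lemma mass_matrix_data :
  gram O Phi Phi = mass_of_data (fun i : 'I_nt.+1 => D i).
Proof.
apply: block_inj => l j; rewrite block_mass -gram_lag; try exact: ltnW.
by apply/matrixP => a b; rewrite mxE !gramE !col_snapshots !col_snapshot.
Qed.

Lemma stiffness_matrix_data :
  gram O Phi (colwise (U dt) Phi) = stiffness_of_data (fun i : 'I_nt.+1 => D i).
Proof.
apply: block_inj => l j; rewrite block_stiffness -gram_lag//; last exact: ltnW.
apply/matrixP => a b; rewrite mxE !gramE !col_snapshots !col_snapshot.
set F := fun x => col _ (colwise _ _ x).
have -> : F = U dt (psi (tnth E b) (j%:R * dt + tau)).
  apply/funext => x; apply/matrixP => i z; rewrite /F !mxE ord1.
  by rewrite col_snapshots.
have -> : j.+1%:R * dt + tau = j%:R * dt + tau + dt by rewrite -natr1 mulrDl mul1r addrAC.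
rewrite (propagation gU ts_gt0 (hf (mem_tnth b E)) (hpsi (mem_tnth b E)))//.
- exact: snapshot_L2.
- by rewrite (le_trans ts_tau)// lerDr mulr_ge0// ltW.
- exact: ltW.
Qed.

End rom_data.

(** * The reduced order model from the data matrices *)

Unset Implicit Arguments. Set Strict Implicit. Set Printing Implicit Defensive.

Theorem theorem2p2 (R : realType) (nt nE : nat)
    (chol : 'M[R]_(\sum_(j < nt) nE) -> 'M[R]_(\sum_(j < nt) nE))
    (nt_gt0 : (0 < nt)%N) (nE_gt0 : (0 < nE)%N)
    (chol_rule : block_cholesky_rule chol) :
  exists rom_of_data : ('I_nt.+1 -> 'M[R]_nE) ->
      'M[R]_(\sum_(j < nt) nE) * (nat -> 'M[R]_(\sum_(j < nt) nE, nE)),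
  forall (d m : nat) (O : set 'rV[R]_d) (L : operator R d m)
    (U : R -> ('rV[R]_d -> 'cV[R]_m) -> ('rV[R]_d -> 'cV[R]_m))
    (E : nE.-tuple (nat * nat)) (ts tau dt : R)
    (f psi : nat * nat -> R -> 'rV[R]_d -> 'cV[R]_m)
    (g : nat -> 'M[R]_(\sum_(j < nt) nE, nE)),
  let phi := snapshot E tau dt psi in
  let Phi := snapshots E nt tau dt psi in
  let M := gram O Phi Phi in
  let S := gram O Phi (colwise (U dt) Phi) in
  let Rm := chol M in
  let P_rom := rom_propagator S Rm in
  let phi_rom := fun j : nat => Rm *m g j in
  let D := data_matrix O E ts dt f psi in
  (d = 2 \/ d = 3)%N ->
  admissible_domain O ->
  skew_adjoint O L ->
  first_order_pdo O L -> homogeneous_bc O L ->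
  is_exp_opp O L U ->
  uniq E ->
  0 < ts -> ts <= tau -> 0 < dt ->
  (forall e, e \in E -> is_force O ts (f e)) ->
  (forall e, e \in E -> is_wave_field O U ts (f e) (psi e)) ->
  L2_free_columns O Phi ->
  galerkin M S Rm g ->
  [/\ (forall j : nat, (j < nt)%N ->
         D j = gram O (phi 0%N) (phi j) /\
         gram O (phi 0%N) (phi j) = (phi_rom 0%N)^T *m phi_rom j),
      rom_of_data (fun j : 'I_nt.+1 => D j) = (P_rom, phi_rom) &
      (forall l j : 'I_nt, (j.+1 < l)%N -> block P_rom l j = 0) /\
      (forall l j : 'I_nt, l = j.+1 :> nat -> block P_rom l j <> 0)].
Proof.
exists (fun D => let M := mass_of_data D in let S := stiffness_of_data D in
  let Rm := chol M in
  (rom_propagator S Rm, fun j => Rm *m galerkin_seq M S j)).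
move=> d m O L U E ts tau dt f psi g phi Phi M S Rm P_rom phi_rom D.
move=> _ _ _ _ _ [gU _] _ ts0 tstau dt0 hf hpsi free gal.
have Mdata : M = mass_of_data (fun j : 'I_nt.+1 => D j).
  exact: (mass_matrix_data nt gU ts0 tstau dt0 hf hpsi).
have Sdata : S = stiffness_of_data (fun j : 'I_nt.+1 => D j).
  exact: (stiffness_matrix_data nt gU ts0 tstau dt0 hf hpsi).
have Mpos : sym_pos_def M.
  apply: gram_sym_pos_def free => k; rewrite -[k]tagnat.sig2K col_snapshots.
  exact: (snapshot_L2 hpsi).
have Dgram j : D j = gram O (phi 0%N) (phi j).
  exact: (data_gram gU ts0 tstau dt0 hf hpsi).
(* From here on, only the blocks of M and S in terms of the data matter. *)
clearbody M S D.
have [Rup RtR] := chol_rule M Mpos.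
have shift (l j k : 'I_nt) : k = j.+1 :> nat -> block S l j = block M l k.
  by move=> kj; rewrite Sdata Mdata block_stiffness block_mass kj.
have gE := galerkin_unique Mpos RtR gal.
split.
- move=> j jnt; split; first exact: Dgram.
  rewrite -Dgram /phi_rom !gE (rom_inner nt_gt0 Mpos RtR shift jnt).
  by rewrite Mdata block_mass /lag leq0n subn0 inordK// ltnS ltnW.
- rewrite /= -Mdata -Sdata /P_rom; apply: f_equal2 => //.
  by apply/funext => j; rewrite /phi_rom gE.
- split=> l j lj; first exact: (propagator_hessenberg Mpos Rup RtR shift lj).
  exact: (propagator_unreduced nE_gt0 Mpos Rup RtR shift lj).
Qed.
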